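(* Let $0<a<b$, let $X$ be a random variable with values in $[a,b]$, $\mu=\mathbb{E}X$, $\sigma^2=\mathrm{Var}[X]$, and let $R_n, C_n$ be the effective resistance and effective conductance of the random network $T_n$ defined in the context. There exist constants $M_1,M_2$ depending only on $a$ and $b$ such that for all integers $n\ge 2$, $$\left|\mathbb{E}R_n-\mu n+\frac{\sigma^2}{\mu}\ln n\right|\le M_1\quad\text{and}\quad\left|\mathbb{E}C_n-\frac{1}{\mu n}-\frac{\sigma^2\ln n}{\mu^3n^2}\right|\le\frac{M_2}{n^2}.$$
   Context: For $n\ge1$, $T_n$ is the edge-rooted tree consisting of a root vertex $r$ joined by a single edge to a vertex $v$, where $v$ is the root of a complete binary tree with $n-1$ levels (so $T_n$ has $2^{n-1}$ leaves at distance $n$ from $r$). The depth $d(e)$ of an edge $e$ is the number of edges on the path that starts with $e$ and ends at $r$; the edge at $r$ has depth $1$. Each edge $e$ is given resistance $r_e=2^{d(e)-1}X_e$, with the $X_e$ i.i.d. copies of $X$. $R_n$ is the effective resistance between $r$ and the set of leaves of $T_n$, and $C_n=1/R_n$ is the effective conductance. *)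

(* Defs.v *)
From HB Require Import structures.
From mathcomp Require Import all_boot all_order all_algebra.
From mathcomp Require Import all_classical all_reals all_analysis.
Set Implicit Arguments. Unset Strict Implicit. Unset Printing Implicit Defensive.
Import Order.TTheory GRing.Theory Num.Theory.
Local Open Scope classical_set_scope.
Local Open Scope ring_scope.

(* The tree T_n.  Vertices: the root r is (0,0); for 1 <= k <= n the
   vertices at distance k from r are (k,i) with i < 2^(k-1).  The parent of
   (k,i) (k >= 1) is (k-1, i %/ 2).  Every edge e is identified with its
   endpoint (k,i) farther from r; its depth is d(e) = k, and its resistance is
   r_e = 2^(k-1) * x k i (x k i playing the role of X_e).  The leaves are the
   (n,i), i < 2^(n-1). *)

Definition tree_energy {R : realType} (n : nat) (x : nat -> nat -> R)
    (f : nat -> nat -> R) : R :=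
  \sum_(1 <= k < n.+1) \sum_(i < (2 ^ k.-1)%N)
     (f k i - f k.-1 (i %/ 2)%N) ^+ 2 / ((2 ^ k.-1)%N%:R * x k i).

Definition tree_admissible {R : realType} (n : nat) (f : nat -> nat -> R) :=
  f 0%N 0%N = 1 /\ forall i, (i < 2 ^ n.-1)%N -> f n i = 0.

(* effective conductance between r and the set of leaves (Dirichlet principle) *)
Definition eff_conductance {R : realType} (n : nat) (x : nat -> nat -> R) : R :=
  inf [set tree_energy n x f | f in tree_admissible n].

Definition eff_resistance {R : realType} (n : nat) (x : nat -> nat -> R) : R :=
  (eff_conductance n x)^-1.

Definition mutually_independent {d} {T : measurableType d} {R : realType}
    (P : probability T R) {I : eqType} (Y : I -> {RV P >-> R}) : Prop :=
  forall (J : seq I) (B : I -> set R), uniq J ->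
    (forall j, j \in J -> measurable (B j)) ->
    fine (P [set w | forall j, j \in J -> B j (Y j w)]) =
    \prod_(j <- J) fine (P (Y j @^-1` B j)).
Arguments mutually_independent {d T R} P {I} Y.

(* Main.v *)
Require Import Defs.
From HB Require Import structures.
From mathcomp Require Import all_boot all_order all_algebra.
From mathcomp Require Import all_classical all_reals all_analysis.
From mathcomp Require Import measurable_realfun ring lra zify.
Import Order.TTheory GRing.Theory Num.Theory.
Local Open Scope classical_set_scope.
Local Open Scope ring_scope.

(* By the series and parallel laws, R_(n+1) is distributed as X + h(U, V), where
   U and V are independent copies of R_n, independent of X, and h is the harmonic
   mean.  In terms of conductances, C_(n+1) = A / (1 + X A) where A is the mean of
   two independent copies of C_n.  The map A |-> A / (1 + x A) is 1-Lipschitz,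
   averaging halves the variance, and freezing X costs O(1/n^2); hence the central
   moments of C_n of order 2 and 4 are O(n^-4) and O(n^-8).  Since R_n is of order
   n, its fourth central moment is therefore bounded.

   Now h(U, V) = (U + V) / 2 - Q with Q = (U - V)^2 / (2 (U + V)).  As E Q^2 is
   O(1/n^2), Var R_(n+1) = sigma^2 + Var R_n / 2 + O(1/n), so Var R_n = 2 sigma^2
   + O(1/n), and with m_n = E R_n one gets E Q = sigma^2 / m_n + O(1/n^2), that is
   m_(n+1) = m_n + mu - sigma^2 / m_n + O(1/n^2).  Thus the increments of
   m_n + (sigma^2 / mu) ln m_n - mu n are O(1/n^2) and it stays bounded, while
   ln m_n = ln n + O(1).  Finally E C_n = 1 / m_n + O(Var R_n / n^3). *)

(** Variance does not contract directly at the level of resistances: the partial derivative of [h]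
    in [r] is [2 (s / (r + s))^2], close to 2 when [r] is much smaller than [s], and the a priori
    bounds [a n <= R_n <= b n] allow ratios down to [a / b]. On conductances the average is exactly
    linear, so the moments are bounded there first; the rate [n^-8] is just what survives the factor
    of order [n^8] paid for inverting back. Fourth moments are needed because [Q] is quadratic in
    [U - V]. No fresh copies [U], [V] are constructed: they are the resistances of the two subtrees
    below the root edge, and the work lies in showing that they are independent with the law of the
    shallower tree. The constants must precede the choice of the probability space. The
    probabilistic part therefore only delivers the inequalities of [moment_profile], and a
    deterministic part treats all profiles with the same [a], [b] at once. *)

Section Network.
Set Implicit Arguments. Unset Strict Implicit.
Context {R : realType}.
Implicit Types (x f : nat -> nat -> R) (a b : R).

(** The parallel law after rescaling: resistances double at each level, and [2 r] in parallel with
    [2 s] is [hmean r s]. *)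
Definition hmean (r s : R) : R := 2 / (r^-1 + s^-1).

(* [res x m k i] is, up to the factor [2 ^ k.-1], the resistance of the branch
   hanging from the edge [(k, i)] and cut after [m] levels of edges; the junk
   value [hmean 0 0 = 0] makes [res x 1 k i = x k i]. *)
Fixpoint res x (m k i : nat) : R :=
  if m is m'.+1 then
    x k i + hmean (res x m' k.+1 i.*2) (res x m' k.+1 i.*2.+1)
  else 0.

Lemma hmean_bounds r s l u : 0 < l -> l <= r <= u -> l <= s <= u ->
  l <= hmean r s <= u.
Proof.
move=> l0 /andP[lr ru] /andP[ls su].
have r0 : 0 < r := lt_le_trans l0 lr.
have s0 : 0 < s := lt_le_trans l0 ls.
have u0 : 0 < u := lt_le_trans r0 ru.
have D0 : 0 < r^-1 + s^-1 by rewrite addr_gt0 ?invr_gt0.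
have H1 : r^-1 <= l^-1 by rewrite lef_pV2 ?posrE.
have H2 : s^-1 <= l^-1 by rewrite lef_pV2 ?posrE.
have H3 : u^-1 <= r^-1 by rewrite lef_pV2 ?posrE.
have H4 : u^-1 <= s^-1 by rewrite lef_pV2 ?posrE.
rewrite /hmean ler_pdivlMr// ler_pdivrMr//; apply/andP; split.
  have -> : 2 = l * (l^-1 + l^-1) by field; rewrite gt_eqF.
  by rewrite ler_pM2l// lerD.
have -> : 2 = u * (u^-1 + u^-1) by field; rewrite gt_eqF.
by rewrite ler_pM2l// lerD.
Qed.

Lemma res_bounds a b x m k i : 0 < a -> (forall k i, a <= x k i <= b) ->
  a * m%:R <= res x m k i <= b * m%:R.
Proof.
move=> a0 xab; elim: m k i => [|m IH] k i /=; first by rewrite !mulr0 lexx.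
have /andP[ax xb] := xab k i.
(* A single level is separate: its children have resistance 0, out of reach of [hmean_bounds]. *)
case: m IH => [|m] IH.
  by rewrite /= /hmean invr0 addr0 invr0 mulr0 addr0 !mulr1 ax xb.
have am : 0 < a * m.+1%:R by rewrite mulr_gt0.
have /andP[h1 h2] := hmean_bounds am (IH k.+1 i.*2) (IH k.+1 i.*2.+1).
by rewrite -[m.+2]addn1 natrD !mulrDr !mulr1; apply/andP; split; lra.
Qed.

Lemma sum_double (F : nat -> R) N :
  \sum_(i < N.*2) F i = \sum_(i < N) (F i.*2 + F i.*2.+1).
Proof.
elim: N => [|N IH]; first by rewrite !big_ord0.
by rewrite doubleS !big_ord_recr /= IH addrA.
Qed.

(* [(y - u)^2 / X + y^2 A - u^2 / (X + A^-1)] is the square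
   [((1 + X A) y - u)^2 / (X (1 + X A))], where [A = (r^-1 + s^-1) / 2]. *)
Lemma branch_energyE (X r s u y N : R) : 0 < X -> 0 < r -> 0 < s -> 0 < N ->
  (y - u) ^+ 2 / (N * X) + (y ^+ 2 / (N * 2 * r) + y ^+ 2 / (N * 2 * s)) =
  u ^+ 2 / (N * (X + hmean r s)) +
  ((1 + X * ((r^-1 + s^-1) / 2)) * y - u) ^+ 2 /
    (N * X * (1 + X * ((r^-1 + s^-1) / 2))).
Proof.
move=> X0 r0 s0 N0; rewrite /hmean.
have ? : X * r + X * s + 2 * r * s != 0.
  by rewrite gt_eqF// !addr_gt0 ?mulr_gt0.
field; rewrite !gt_eqF// ?addr_gt0 ?mulr_gt0 ?addr_gt0 ?mulr_gt0 //.
Qed.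

End Network.

(** * The Dirichlet principle on the tree *)

Section Dirichlet.
Set Implicit Arguments. Unset Strict Implicit.
Context {R : realType}.
Implicit Types (x f : nat -> nat -> R) (a b : R).

Let edge_level x f k :=
  \sum_(i < (2 ^ k.-1)%N)
     (f k i - f k.-1 (i %/ 2)%N) ^+ 2 / ((2 ^ k.-1)%N%:R * x k i).

(* the energy of the levels [k, ..., n] once [f] is relaxed to its harmonic
   extension below level [k.-1] *)
Let relaxed n x f k :=
  \sum_(i < (2 ^ k.-1)%N)
     f k.-1 (i %/ 2)%N ^+ 2 / ((2 ^ k.-1)%N%:R * res x (n.+1 - k) k i).

(** Equal currents [(u - y) / X] through the edge and [y A] below it force [u = (1 + X A) y]: the
    harmonic potential is divided by [slope] at each step down. *)
Let slope x m k i :=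
  1 + x k i * (((res x m k.+1 i.*2)^-1 + (res x m k.+1 i.*2.+1)^-1) / 2).

Let defect n x f k :=
  \sum_(i < (2 ^ k.-1)%N)
     (slope x (n - k) k i * f k i - f k.-1 (i %/ 2)%N) ^+ 2 /
       ((2 ^ k.-1)%N%:R * x k i * slope x (n - k) k i).

(** The minimiser, built downwards so that every [defect] vanishes; the test [k < n] puts 0 on the
    leaves. *)
Fixpoint potential n x (k i : nat) : R :=
  if k is k'.+1 then
    if (k < n)%N then potential n x k' (i %/ 2)%N / slope x (n - k) k i else 0
  else 1.

Variables (a b : R) (x : nat -> nat -> R).
Hypotheses (a0 : 0 < a) (xab : forall k i, a <= x k i <= b).

Let x_gt0 k i : 0 < x k i.
Proof. by have /andP[+ _] := xab k i; exact: lt_le_trans. Qed.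

Lemma res_gt0 m k i : 0 < res x m.+1 k i.
Proof.
have /andP[+ _] := res_bounds m.+1 k i a0 xab.
by apply: lt_le_trans; rewrite mulr_gt0.
Qed.

Let slope_gt0 m k i : (0 < m)%N -> 0 < slope x m k i.
Proof.
case: m => // m _; have := res_gt0 m k.+1 i.*2.
have := res_gt0 m k.+1 i.*2.+1 => h1 h2.
by rewrite addr_gt0// mulr_gt0// mulr_gt0 ?addr_gt0 ?invr_gt0.
Qed.

Let relaxedE n f k : (0 < k < n)%N ->
  edge_level x f k + relaxed n x f k.+1 = relaxed n x f k + defect n x f k.
Proof.
move=> /andP[k0 kn]; rewrite /edge_level /relaxed /defect subSS -!big_split /=.
have -> : (2 ^ k)%N = (2 ^ k.-1).*2 by rewrite -muln2 -expnSr prednK.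
rewrite (sum_double (fun i => f k (i %/ 2)%N ^+ 2 /
  ((2 ^ k.-1).*2%:R * res x (n - k) k.+1 i))) -!big_split /=.
apply: eq_bigr => i _.
rewrite subSn ?(ltnW kn)//=.
have [m ->] : exists m, (n - k = m.+1)%N by exists (n - k).-1; lia.
have -> : (i.*2 %/ 2)%N = i by lia.
have -> : (i.*2.+1 %/ 2)%N = i by lia.
rewrite -[(2 ^ k.-1).*2]muln2 natrM.
by rewrite branch_energyE// ?res_gt0// ltr0n expn_gt0.
Qed.

Let defect_ge0 n f k : (k < n)%N -> 0 <= defect n x f k.
Proof.
move=> kn; apply: sumr_ge0 => i _.
by rewrite mulr_ge0 ?sqr_ge0// invr_ge0 mulr_ge0 ?ltW ?slope_gt0 ?subn_gt0//
   mulr_gt0// ltr0n expn_gt0.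
Qed.

(** Completing the square level by level, through [relaxedE], turns the energy into the value of the
    minimum plus nonnegative defects. *)
Let tree_energyE n f : (0 < n)%N -> (forall i, (i < 2 ^ n.-1)%N -> f n i = 0) ->
  tree_energy n x f =
  f 0%N 0%N ^+ 2 / res x n 1 0 + \sum_(1 <= k < n) defect n x f k.
Proof.
move=> n0 fn.
have H j : (0 < j <= n)%N ->
    \sum_(1 <= k < j) edge_level x f k + relaxed n x f j =
    relaxed n x f 1 + \sum_(1 <= k < j) defect n x f k.
  elim: j => // -[|j] IH jn; first by rewrite !big_geq// add0r addr0.
  rewrite !(big_nat_recr j.+1)//= -addrA relaxedE; last lia.
  by rewrite addrA IH; [rewrite -addrA|lia].
have -> : tree_energy n x f = \sum_(1 <= k < n.+1) edge_level x f k by [].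
rewrite big_nat_recr//=.
(* On the leaves [f] is 0 and [res x 1] is a single edge, so nothing is left to relax. *)
have -> : edge_level x f n = relaxed n x f n.
  apply: eq_bigr => i _; rewrite fn// sub0r sqrrN subSnn/= /hmean.
  by rewrite invr0 addr0 invr0 mulr0 addr0.
by rewrite H ?n0 ?leqnn// {1}/relaxed big_ord1 subn1/= div0n mul1r.
Qed.

Lemma eff_conductanceE n : (0 < n)%N -> eff_conductance n x = (res x n 1 0)^-1.
Proof.
move=> n0; rewrite /eff_conductance; set E := (X in inf X).
have Elb f : tree_admissible n f -> (res x n 1 0)^-1 <= tree_energy n x f.
  move=> [f0 fn]; rewrite tree_energyE// f0 expr1n mul1r lerDl.
  by rewrite big_nat; apply: sumr_ge0 => k /andP[_ kn]; exact: defect_ge0.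
have Ein : E (res x n 1 0)^-1.
  exists (potential n x).
    by split=> // i _; case: n n0 {E Elb} => //= n _; rewrite ltnn.
  rewrite tree_energyE//=; last first.
    by move=> i _; case: n n0 {E Elb} => //= n _; rewrite ltnn.
  rewrite expr1n mul1r big_nat big1 ?addr0// => k /andP[k0 kn].
  apply: big1 => i _; case: k k0 kn i => //= k _ kn i.
  rewrite kn [X in X - _]mulrC divfK ?subrr ?expr0n ?mul0r//=.
  by rewrite gt_eqF// slope_gt0// subn_gt0.
apply/eqP; rewrite eq_le; apply/andP; split.
  by apply: ge_inf => //; exists (res x n 1 0)^-1 => _ [f fa <-]; exact: Elb.
by apply: lb_le_inf; [exists (res x n 1 0)^-1|move=> _ [f fa <-]; exact: Elb].
Qed.

End Dirichlet.

Lemma measurable_preimage {d d' : measure_display} {T : measurableType d}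
    {T' : measurableType d'} {f : T -> T'} {B : set T'} :
  measurable_fun setT f -> measurable B -> measurable (f @^-1` B).
Proof. by move=> mf mB; rewrite -[X in measurable X]setTI; exact: mf. Qed.

(** * Expectations of bounded random variables *)

Section Expectation.
Set Implicit Arguments. Unset Strict Implicit.
Context {d : measure_display} {T : measurableType d} {R : realType}
  (P : probability T R).
Implicit Types (f g : T -> R).

(** A class closed under the ring operations and contained in the integrable functions, so that
    linearity of [Ex] has only mechanical side conditions. *)
Definition bounded_mfun f :=
  measurable_fun setT f /\ exists K : R, forall w, `|f w| <= K.

Definition Ex f : R := \int[P]_w f w.

Lemma bounded_mfun_cst (r : R) : bounded_mfun (fun=> r).
Proof. by split=> //; exists `|r|. Qed.

Lemma bounded_mfunD f g : bounded_mfun f -> bounded_mfun g ->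
  bounded_mfun (fun w => f w + g w).
Proof.
move=> [mf [K fK]] [mg [L gL]]; split; first exact: measurable_funD.
by exists (K + L) => w; rewrite (le_trans (ler_normD _ _))// lerD.
Qed.

Lemma bounded_mfunN f : bounded_mfun f -> bounded_mfun (fun w => - f w).
Proof.
move=> [mf [K fK]]; split; first exact: measurable_funN.
by exists K => w; rewrite normrN.
Qed.

Lemma bounded_mfunM f g : bounded_mfun f -> bounded_mfun g ->
  bounded_mfun (fun w => f w * g w).
Proof.
move=> [mf [K fK]] [mg [L gL]]; split; first exact: measurable_funM.
by exists (K * L) => w; rewrite normrM ler_pM.
Qed.

Lemma bounded_mfunX f n : bounded_mfun f -> bounded_mfun (fun w => f w ^+ n).
Proof.
move=> bf; elim: n => [|n IH]; first exact: bounded_mfun_cst.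
by under eq_fun do rewrite exprS; exact: bounded_mfunM.
Qed.

(** On nonnegative reals inversion is the measurable map [powR _ (-1)], at 0 as well, where both
    take the value 0. *)
Lemma measurable_funV_ge0 f : measurable_fun setT f -> (forall w, 0 <= f w) ->
  measurable_fun setT (fun w => (f w)^-1).
Proof.
move=> mf f0; under eq_fun do rewrite -powR_inv1//.
by apply: (@measurableT_comp _ _ _ _ _ _ (fun x => x `^ (-1))) => //;
  exact: measurable_powR.
Qed.

Lemma bounded_mfunV f c : 0 < c -> (forall w, c <= f w) -> bounded_mfun f ->
  bounded_mfun (fun w => (f w)^-1).
Proof.
move=> c0 cf [mf _]; have f0 w : 0 < f w := lt_le_trans c0 (cf w).
split; first by apply: measurable_funV_ge0 => // w; rewrite ltW.
exists c^-1 => w; rewrite ger0_norm ?invr_ge0 ?(ltW (f0 w))//.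
by rewrite lef_pV2 ?posrE.
Qed.

Lemma bounded_mfun_integrable f :
  bounded_mfun f -> P.-integrable setT (EFin \o f).
Proof.
move=> [mf [K fK]]; apply: measurable_bounded_integrable => //.
  by rewrite ltey_eq fin_num_measure.
exists K; split; first exact: num_real.
by move=> y Ky w _; apply: (le_trans (fK w)); rewrite ltW.
Qed.

Lemma eq_Ex f g : f =1 g -> Ex f = Ex g.
Proof. by move=> fg; apply: eq_Rintegral => w _; exact: fg. Qed.

Lemma Ex_cst (r : R) : Ex (fun=> r) = r.
Proof. by rewrite /Ex Rintegral_cst//= probability_setT/= mulr1. Qed.

Lemma ExD f g : bounded_mfun f -> bounded_mfun g ->
  Ex (fun w => f w + g w) = Ex f + Ex g.
Proof. by move=> bf bg; apply: RintegralD => //; exact: bounded_mfun_integrable. Qed.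

Lemma ExB f g : bounded_mfun f -> bounded_mfun g ->
  Ex (fun w => f w - g w) = Ex f - Ex g.
Proof. by move=> bf bg; apply: RintegralB => //; exact: bounded_mfun_integrable. Qed.

Lemma ExZ (r : R) f : bounded_mfun f -> Ex (fun w => r * f w) = r * Ex f.
Proof. by move=> bf; apply: RintegralZl => //; exact: bounded_mfun_integrable. Qed.

Lemma le_Ex f g : bounded_mfun f -> bounded_mfun g ->
  (forall w, f w <= g w) -> Ex f <= Ex g.
Proof.
by move=> bf bg fg; apply: le_Rintegral => //; exact: bounded_mfun_integrable.
Qed.

Lemma Ex_EFin f : bounded_mfun f -> (\int[P]_w (f w)%:E)%E = (Ex f)%:E.
Proof.
move=> bf; rewrite /Ex /Rintegral fineK//.
by apply: integrable_fin_num => //; exact: bounded_mfun_integrable.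
Qed.

(** Both sides are integrals over the pushforward laws; [h] is replaced by its absolute value
    because it is nonnegative only along [U] and [V]. *)
Lemma eq_law_Ex (U V : T -> R) (h : R -> R) :
  measurable_fun setT U -> measurable_fun setT V -> measurable_fun setT h ->
  (forall w, 0 <= h (U w)) -> (forall w, 0 <= h (V w)) ->
  (forall B : set R, measurable B -> P (U @^-1` B) = P (V @^-1` B)) ->
  Ex (h \o U) = Ex (h \o V).
Proof.
move=> mU mV mh hU hV UV; rewrite /Ex /Rintegral; congr fine.
have mh' : measurable_fun setT (fun y : R => `|h y|%:E).
  by apply/measurable_EFinP; exact: measurableT_comp.
transitivity (\int[pushforward P U]_y `|h y|%:E)%E.
  rewrite ge0_integral_pushforward ?preimage_setT//.
  by apply: eq_integral => w _; rewrite /= ger0_norm.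
transitivity (\int[pushforward P V]_y `|h y|%:E)%E; last first.
  rewrite ge0_integral_pushforward ?preimage_setT//.
  by apply: eq_integral => w _; rewrite /= ger0_norm.
by apply: eq_measure_integral => B mB _; exact: UV.
Qed.

End Expectation.
Arguments Ex {d T R} P f.

(** * Product laws and independence *)

Section Joint_law.
Set Implicit Arguments. Unset Strict Implicit.
Context {d d1 d2 : measure_display} {T : measurableType d}
  {T1 : measurableType d1} {T2 : measurableType d2} {R : realType}
  (P : probability T R).

(** The law of [(U, V)] conditioned on [H] agrees with the product on rectangles, hence everywhere.
    Keeping an event [H] allows nesting, as needed for a triple in [res_law]. *)
Lemma joint_law (H : set T) (U : T -> T1) (V : T -> T2)
    (l1 : probability T1 R) (l2 : probability T2 R) :
  measurable H -> measurable_fun setT U -> measurable_fun setT V ->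
  (forall A B, measurable A -> measurable B ->
     P (H `&` (U @^-1` A `&` V @^-1` B)) = (P H * (l1 A * l2 B))%E) ->
  forall C, measurable C ->
    P (H `&` (fun w => (U w, V w)) @^-1` C) = (P H * (l1 \x l2)%E C)%E.
Proof.
move=> mH mU mV HUV C mC.
have mUV : measurable_fun setT (fun w => (U w, V w)).
  exact/measurable_fun_pair.
have mpre := measurable_preimage mUV mC.
have [PH0|PH0] := eqVneq (P H) 0%E.
  rewrite PH0 mul0e; apply: (subset_measure0 _ mH _ PH0) => //.
  exact: measurableI.
have PHfin : P H \is a fin_num by exact: fin_num_measure.
have p0 : 0 < fine (P H) by rewrite fine_gt0// lt0e PH0 measure_ge0/= ltey_eq PHfin.
have r0 : 0 <= (fine (P H))^-1 by rewrite invr_ge0 ltW.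
(* the measure structure of the pushforward abstracts over measurability *)
pose m0 : {measure set (T1 * T2) -> \bar R} :=
  mscale (NngNum r0) (pushforward (mrestr P mH) (fun w => (U w, V w))).
pose m' := m0 mUV.
have m'E X : m' X =
    ((fine (P H))^-1%:E * P (H `&` (fun w => (U w, V w)) @^-1` X))%E.
  by rewrite setIC.
rewrite (@product_measure_unique _ _ _ _ _ l1 l2 m' _ C mC).
  rewrite m'E muleA -[X in (X * _ * _)%E](fineK PHfin) -EFinM divff ?mul1e//.
  by rewrite gt_eqF.
move=> A B mA mB; rewrite m'E HUV// muleA -[X in (_ * X * _)%E](fineK PHfin).
by rewrite -EFinM mulVf ?mul1e// gt_eqF.
Qed.

End Joint_law.

Section Independence.
Set Implicit Arguments. Unset Strict Implicit.
Context {d : measure_display} {T : measurableType d} {R : realType}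
  (P : probability T R).
Implicit Types (U V : T -> R).

Definition independent_pair U V := forall A B : set R,
  measurable A -> measurable B ->
  P (U @^-1` A `&` V @^-1` B) = (P (U @^-1` A) * P (V @^-1` B))%E.

Lemma independent_pair_comp U V (g h : R -> R) :
  measurable_fun setT g -> measurable_fun setT h ->
  independent_pair U V -> independent_pair (g \o U) (h \o V).
Proof.
move=> mg mh UV A B mA mB.
by apply: (UV (g @^-1` A) (h @^-1` B)); exact: measurable_preimage.
Qed.

Let ge0_ExM U V : bounded_mfun U -> bounded_mfun V ->
  (forall w, 0 <= U w) -> (forall w, 0 <= V w) -> independent_pair U V ->
  Ex P (fun w => U w * V w) = Ex P U * Ex P V.
Proof.
move=> bU bV U0 V0 UV; have [mU _] := bU; have [mV _] := bV.
have mUV : measurable_fun setT (fun w => (U w, V w)).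
  exact/measurable_fun_pair.
pose U' : {mfun T >-> R} := HB.pack U (isMeasurableFun.Build _ _ _ _ _ mU).
pose V' : {mfun T >-> R} := HB.pack V (isMeasurableFun.Build _ _ _ _ _ mV).
pose lU : probability R R := distribution P U'.
pose lV : probability R R := distribution P V'.
apply: EFin_inj; rewrite -Ex_EFin; last exact: bounded_mfunM.
rewrite EFinM -!Ex_EFin//.
have mnorm : measurable_fun setT (fun y : R => `|y|%:E).
  exact/measurable_EFinP.
transitivity (\int[pushforward P (fun w => (U w, V w))]_z
    (`|z.1|%:E * `|z.2|%:E))%E.
  rewrite ge0_integral_pushforward ?preimage_setT//.
    by apply: eq_integral => w _; rewrite /= !ger0_norm.
  by apply: emeasurable_funM; apply/measurable_EFinP;
    apply: measurableT_comp.
transitivity (\int[(lU \x lV)%E]_z (`|z.1|%:E * `|z.2|%:E))%E.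
  apply: eq_measure_integral => C mC _.
  have := joint_law (P := P) (l1 := lU) (l2 := lV) measurableT mU mV _ mC.
  rewrite setTI probability_setT mul1e; apply => A B mA mB.
  by rewrite setTI mul1e UV.
rewrite fubini_tonelli1//=; last first.
  by apply: emeasurable_funM; apply/measurable_EFinP;
    apply: measurableT_comp.
rewrite /fubini_F/=.
under eq_integral do rewrite ge0_integralZl//=.
have -> : (\int[lV]_y `|y|%:E = \int[P]_w (V w)%:E)%E.
  rewrite ge0_integral_distribution//.
  by apply: eq_integral => w _; rewrite /= ger0_norm.
rewrite Ex_EFin// ge0_integralZr//=; last first.
  by rewrite lee_fin Rintegral_ge0.
congr (_ * _)%E; rewrite ge0_integral_distribution//.
by apply: eq_integral => w _; rewrite /= ger0_norm.
Qed.

(** Adding the bounds [K] and [L] makes both factors nonnegative, the case settled by Tonelli;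
    bilinearity then removes the shifts. *)
Lemma ExM U V : bounded_mfun U -> bounded_mfun V -> independent_pair U V ->
  Ex P (fun w => U w * V w) = Ex P U * Ex P V.
Proof.
move=> bU bV UV; have [_ [K UK]] := bU; have [_ [L VL]] := bV.
have bK := bounded_mfun_cst K (d := d) (T := T).
have bL := bounded_mfun_cst L (d := d) (T := T).
have := ge0_ExM (bounded_mfunD bU bK) (bounded_mfunD bV bL).
have -> : Ex P (fun w => (U w + K) * (V w + L)) =
    Ex P (fun w => U w * V w) + (L * Ex P U + K * Ex P V + K * L).
  rewrite (@eq_Ex _ _ _ _ _
    (fun w => U w * V w + (L * U w + K * V w + K * L))); last by move=> w; ring.
  have bKL := bounded_mfun_cst (K * L) (d := d) (T := T).
  by rewrite !ExD ?ExZ ?Ex_cst//; do ?[apply: bounded_mfunD|apply: bounded_mfunM].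
rewrite !ExD// !Ex_cst => H.
suff : Ex P (fun w => U w * V w) + (L * Ex P U + K * Ex P V + K * L) =
    (Ex P U + K) * (Ex P V + L) by move=> E; lra.
apply: H => [w|w|].
- by have := UK w; rewrite ler_norml => /andP[+ _]; lra.
- by have := VL w; rewrite ler_norml => /andP[+ _]; lra.
- apply: (independent_pair_comp (g := fun x => x + K) (h := fun x => x + L)) => //;
  exact: measurable_funD.
Qed.

End Independence.

(** * Laws and independence of branch resistances *)

Section Tree_law.
Set Implicit Arguments. Unset Strict Implicit.
Context {d : measure_display} {T : measurableType d} {R : realType}
  (P : probability T R) (a b : R) (Y : nat -> nat -> T -> R)
  (nu : probability R R).
Hypotheses (a0 : 0 < a) (Yab : forall k i w, a <= Y k i w <= b)
  (mY : forall k i, measurable_fun setT (Y k i)).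
Implicit Types (G : set T) (S : nat * nat -> Prop) (J : seq (nat * nat)).

Definition cylinder J (B : nat * nat -> set R) : set T :=
  [set w | forall e, e \in J -> B e (Y e.1 e.2 w)].

Let cylinder_cons e J B : cylinder (e :: J) B =
  Y e.1 e.2 @^-1` B e `&` cylinder J B.
Proof.
apply/seteqP; split=> w /=.
  move=> H; split; first by apply: H; rewrite mem_head.
  by move=> e' e'J; apply: H; rewrite in_cons e'J orbT.
by move=> [H1 H2] e'; rewrite in_cons => /orP[/eqP ->//|/H2].
Qed.

Lemma measurable_cylinder J B : (forall e, measurable (B e)) ->
  measurable (cylinder J B).
Proof.
move=> mB; elim: J => [|e J IH].
  suff -> : cylinder [::] B = setT by [].
  by apply/seteqP; split=> // w _ e.
rewrite cylinder_cons; apply: measurableI => //.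
exact: measurable_preimage.
Qed.

(* [G] is independent of the family [(Y e)_(e in S)], itself i.i.d. of law
   [nu]. *)
Definition indep_of G S := forall J B, uniq J -> (forall e, e \in J -> S e) ->
  (forall e, measurable (B e)) ->
  P (G `&` cylinder J B) = (P G * (\prod_(e <- J) fine (nu (B e)))%:E)%E.

(** Cylinders over disjoint lists merge into one over [J ++ J'], so conditioning on the edges of [J]
    does not disturb the others. *)
Let indep_of_cylinder G S S' J B : measurable G -> indep_of G S ->
  uniq J -> (forall e, e \in J -> S e) -> (forall e, measurable (B e)) ->
  (forall e, S' e -> S e /\ e \notin J) -> indep_of (G `&` cylinder J B) S'.
Proof.
move=> mG GS uJ JS mB S'S J' B' uJ' J'S' mB'.
pose B'' e := if e \in J then B e else B' e.
have mB'' e : measurable (B'' e) by rewrite /B''; case: ifP.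
have J'J e : e \in J' -> e \notin J by move=> /J'S' /S'S [].
have -> : G `&` cylinder J B `&` cylinder J' B' = G `&` cylinder (J ++ J') B''.
  rewrite -setIA; congr (_ `&` _); apply/seteqP; split=> w /=.
    move=> [H1 H2] e; rewrite mem_cat /B''; case: ifPn => [/H1//|_ /=].
    exact: H2.
  move=> H; split=> e eJ.
    by have := H e; rewrite mem_cat /B'' eJ; apply.
  by have := H e; rewrite mem_cat /B'' eJ orbT (negPf (J'J _ eJ)); apply.
rewrite !GS//; last first.
- move=> e; rewrite mem_cat => /orP[/JS//|/J'S' /S'S []//].
- rewrite cat_uniq uJ uJ' andbT/=; apply/hasPn => e; exact: J'J.
rewrite -muleA -EFinM big_cat/=; congr (_ * (_ * _)%:E)%E.
  by apply: eq_big_seq => e eJ; rewrite /B'' eJ.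
by apply: eq_big_seq => e eJ; rewrite /B'' (negPf (J'J _ eJ)).
Qed.

Let indep_of1 G S S' k i B : measurable G -> indep_of G S -> S (k, i) ->
  measurable B -> (forall e, S' e -> S e /\ e != (k, i)) ->
  P (G `&` Y k i @^-1` B) = (P G * nu B)%E /\
  indep_of (G `&` Y k i @^-1` B) S'.
Proof.
move=> mG GS Ski mB S'S.
have E : Y k i @^-1` B = cylinder [:: (k, i)] (fun=> B).
  by rewrite cylinder_cons/= -[LHS]setIT; congr (_ `&` _); apply/seteqP; split.
rewrite E; split.
  rewrite GS//=; last by move=> e; rewrite inE => /eqP ->.
  by rewrite big_seq1 fineK// fin_num_measure.
apply: (@indep_of_cylinder _ S) => //.
  by move=> e; rewrite inE => /eqP ->.
by move=> e; rewrite inE; exact: S'S.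
Qed.

(** The quotient by [2 ^ (e.1 - k)] is the index of the ancestor of [e] at level [k]. *)
Definition branch k i (e : nat * nat) : Prop :=
  (k <= e.1)%N /\ (e.2 %/ 2 ^ (e.1 - k))%N = i.

Let branch_root k i : branch k i (k, i).
Proof. by split=> //=; rewrite subnn expn0 divn1. Qed.

Let branch_child k i j e : (j %/ 2)%N = i -> branch k.+1 j e ->
  branch k i e /\ e != (k, i).
Proof.
case: e => e1 e2 ji [/= ke ej]; split.
  split; first exact: ltnW.
  rewrite -ji -ej /= -[in RHS](expn1 2) -divnMA -expnD.
  by congr (_ %/ 2 ^ _)%N; lia.
by apply/eqP => -[E _]; rewrite E ltnn in ke.
Qed.

Let branch_disjoint k i j e : i != j -> branch k i e -> ~ branch k j e.
Proof. by move=> /eqP ij [_ h1] [_ h2]; apply: ij; rewrite -h1 -h2. Qed.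

Lemma res_ge0 m k i w : 0 <= res (fun k i => Y k i w) m k i.
Proof.
have /andP[+ _] := res_bounds m k i a0 (fun k i => Yab k i w).
by apply: le_trans; rewrite mulr_ge0// ltW.
Qed.

Lemma measurable_res m k i :
  measurable_fun setT (fun w => res (fun k i => Y k i w) m k i).
Proof.
elim: m k i => [|m IH] k i //=.
apply: measurable_funD => //; apply: measurable_funM => //.
by apply: measurable_funV_ge0 => [|w];
  [apply: measurable_funD; apply: measurable_funV_ge0 => // w|
   rewrite addr_ge0// invr_ge0]; rewrite res_ge0.
Qed.

(* [lam] is the law of [res m k i] for every edge [(k, i)], and this resistance
   is independent of everything outside the branch below that edge. *)
Definition factors_over m (lam : probability R R) := forall k i G S (B : set R),
  measurable G -> indep_of G S -> (forall e, branch k i e -> S e) ->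
  measurable B ->
  P (G `&` (fun w => res (fun k i => Y k i w) m k i) @^-1` B) =
    (P G * lam B)%E.

(** The test cylinder avoids the branch, so it can be absorbed into [G] before [factors_over] is
    applied, and released afterwards. *)
Let factors_indep m lam k i G S S' (B : set R) : factors_over m lam ->
  measurable G -> indep_of G S -> (forall e, branch k i e -> S e) ->
  measurable B -> (forall e, S' e -> S e /\ ~ branch k i e) ->
  indep_of (G `&` (fun w => res (fun k i => Y k i w) m k i) @^-1` B) S'.
Proof.
move=> H mG GS brS mB S'S J B' uJ JS' mB'.
have JS e : e \in J -> S e by move=> /JS' /S'S [].
rewrite setIAC (H _ _ _ (fun e => S e /\ e \notin J))//.
- by rewrite GS// (H _ _ _ S)// muleAC.
- by apply: measurableI => //; exact: measurable_cylinder.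
- exact: (@indep_of_cylinder _ S).
- move=> e bre; split; first exact: brS.
  by apply/negP => /JS' /S'S [].
Qed.

(** The map [x + hmean r s] for nonnegative [r], [s], in a form that is visibly measurable
    everywhere. *)
Let step : R * (R * R) -> R :=
  fun z => z.1 + 2 * (z.2.1 `^ (-1) + z.2.2 `^ (-1)) `^ (-1).

Let measurable_step : measurable_fun setT step.
Proof.
have mp : measurable_fun setT (fun x : R => x `^ (-1)) by exact: measurable_powR.
apply: measurable_funD => //; apply: measurable_funM => //.
apply: (measurableT_comp mp); apply: measurable_funD; apply: (measurableT_comp mp).
  exact: measurableT_comp.
exact: measurableT_comp.
Qed.

(** Induction from a Dirac mass at 0: the root edge and the two child branches are revealed one
    after another, each added to the conditioning event. Since [lam] does not depend on the edge,
    equality in law along the tree follows. *)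
Lemma res_law m : exists lam, factors_over m lam.
Proof.
elim: m => [|m [lam IH]].
  exists (dirac (0 : R)) => k i G S B mG _ _ mB /=.
  rewrite diracE; have [|] := boolP (0 \in B); rewrite ?inE ?notin_setE => B0.
    by rewrite mule1; congr (P _); apply/seteqP; split => w; [move=> []|].
  rewrite mule0 [X in P X](_ : _ = set0) ?measure0//.
  by apply/seteqP; split => w // -[_ /B0].
pose step' : {mfun (R * (R * R))%type >-> R} :=
  HB.pack step (isMeasurableFun.Build _ _ _ _ _ measurable_step).
exists (distribution (nu \x (lam \x lam))%E step').
move=> k i G S B mG GS brS mB.
pose r j w := res (fun k i => Y k i w) m k.+1 j.
have mr j : measurable_fun setT (r j) by exact: measurable_res.
have j0 : (i.*2 %/ 2)%N = i by lia.
have j1 : (i.*2.+1 %/ 2)%N = i by lia.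
have -> : (fun w => res (fun k i => Y k i w) m.+1 k i) @^-1` B =
    (fun w => (Y k i w, (r i.*2 w, r i.*2.+1 w))) @^-1` (step @^-1` B).
  have E w : res (fun k i => Y k i w) m.+1 k i =
      step (Y k i w, (r i.*2 w, r i.*2.+1 w)).
    rewrite /step/= /hmean.
    rewrite (powR_inv1 (res_ge0 m k.+1 i.*2 w)).
    rewrite (powR_inv1 (res_ge0 m k.+1 i.*2.+1 w)) powR_inv1//.
    by rewrite addr_ge0// invr_ge0 res_ge0.
  by rewrite (funext E : _ = step \o _) comp_preimage.
apply: (joint_law (V := fun w => (r i.*2 w, r i.*2.+1 w))) => //; last first.
- exact: measurable_preimage.
- move=> A C mA mC; rewrite setIA.
  pose S1 e := branch k.+1 i.*2 e \/ branch k.+1 i.*2.+1 e.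
  have [PG1 G1S] := @indep_of1 G S S1 k i A mG GS (brS _ (branch_root k i)) mA
    (fun e h => match h with
      | or_introl h => let: conj h1 h2 := branch_child j0 h in conj (brS _ h1) h2
      | or_intror h => let: conj h1 h2 := branch_child j1 h in conj (brS _ h1) h2
      end).
  have mG1 : measurable (G `&` Y k i @^-1` A).
    by apply: measurableI => //; exact: measurable_preimage.
  rewrite muleA -PG1; apply: (joint_law mG1) => // A1 A2 mA1 mA2.
  rewrite setIA; have brd : i.*2 != i.*2.+1 by lia.
  rewrite (IH _ _ _ (branch k.+1 i.*2.+1))//.
  + rewrite (IH _ _ _ S1)// -?muleA// => e; exact: or_introl.
  + by apply: measurableI => //; exact: measurable_preimage.
  + apply: (factors_indep IH mG1 G1S) => // e.
      exact: or_introl.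
    move=> h; split; first by right.
    by move=> h'; exact: branch_disjoint brd h' h.
- by apply/measurable_fun_pair.
Qed.

Hypothesis iidY : indep_of setT (fun=> True).

Let indep_setT S : indep_of setT S.
Proof. by move=> J B uJ _ mB; exact: iidY. Qed.

Let law_res m lam k i (B : set R) : factors_over m lam -> measurable B ->
  P ((fun w => res (fun k i => Y k i w) m k i) @^-1` B) = lam B.
Proof.
move=> H mB; have := H k i setT (fun=> True) B measurableT (@indep_setT _)
  (fun _ _ => Logic.I) mB.
by rewrite setTI probability_setT mul1e.
Qed.

Lemma res_eq_law m k i k' i' (B : set R) : measurable B ->
  P ((fun w => res (fun k i => Y k i w) m k i) @^-1` B) =
  P ((fun w => res (fun k i => Y k i w) m k' i') @^-1` B).
Proof.
move=> mB; have [lam H] := res_law m; by rewrite !(law_res _ _ H).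
Qed.

(** The event on the first branch is taken as [G]; it stays independent of the edges of the disjoint
    second branch. *)
Lemma res_sibling_indep m k i j : i != j ->
  independent_pair P (fun w => res (fun k i => Y k i w) m k i)
    (fun w => res (fun k i => Y k i w) m k j).
Proof.
move=> ij A B mA mB; have [lam H] := res_law m.
have mr k0 i0 : measurable_fun setT
  (fun w => res (fun k i => Y k i w) m k0 i0) by exact: measurable_res.
rewrite !(law_res _ _ H)// -[_ `&` _]setTI setIA (H _ _ _ (branch k j))//.
- by rewrite setTI (law_res _ _ H).
- by rewrite setTI; exact: measurable_preimage.
- apply: (factors_indep (S := fun=> True) H) => // e' h; split=> // h'.
  exact: branch_disjoint ij h' h.
Qed.

Lemma root_res_indep m k i j : (j %/ 2)%N = i ->
  independent_pair P (Y k i) (fun w => res (fun k i => Y k i w) m k.+1 j).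
Proof.
move=> ji A B mA mB; have [lam H] := res_law m.
have mr : measurable_fun setT
  (fun w => res (fun k i => Y k i w) m k.+1 j) by exact: measurable_res.
have [PA iA] := indep_of1 (S := fun=> True) (S' := branch k.+1 j) (k := k)
  (i := i) measurableT (@indep_setT _) Logic.I mA
  (fun e h => conj Logic.I (branch_child ji h).2).
rewrite (law_res _ _ H)// -[_ `&` _]setTI setIA (H _ _ _ (branch k.+1 j))// setTI//.
exact: measurable_preimage.
Qed.

End Tree_law.

Ltac bounded := do ?[assumption | exact: bounded_mfun_cst
  | apply: bounded_mfunX | apply: bounded_mfunN | apply: bounded_mfunD
  | apply: bounded_mfunM].

(** Convexity of the fourth power, certified by a sum of squares. *)
Lemma exprB4_le {R : realType} (x y : R) : (x - y) ^+ 4 <= 8 * (x ^+ 4 + y ^+ 4).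
Proof.
rewrite -subr_ge0.
have -> : 8 * (x ^+ 4 + y ^+ 4) - (x - y) ^+ 4 =
  (x + y) ^+ 2 * (2 * x ^+ 2 + 2 * y ^+ 2 + (x - y) ^+ 2) +
  4 * (x ^+ 2 - y ^+ 2) ^+ 2 by ring.
by do ![exact: sqr_ge0 | apply: addr_ge0 | apply: mulr_ge0 | by []].
Qed.

(** * Central moments *)

Section Moments.
Set Implicit Arguments. Unset Strict Implicit.
Context {d : measure_display} {T : measurableType d} {R : realType}
  (P : probability T R).
Implicit Types (f g : T -> R).

Definition cmoment k f : R := Ex P (fun w => (f w - Ex P f) ^+ k).

Lemma Ex_ge0 f : (forall w, 0 <= f w) -> 0 <= Ex P f.
Proof. by move=> f0; apply: Rintegral_ge0. Qed.

Lemma Ex_bounds f l u : bounded_mfun f -> (forall w, l <= f w <= u) ->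
  l <= Ex P f <= u.
Proof.
move=> bf lfu; apply/andP; split; [rewrite -(Ex_cst P l)|rewrite -(Ex_cst P u)];
  by apply: le_Ex; bounded; move=> w; have /andP[] := lfu w.
Qed.

Lemma cmoment2_shift f (r : R) : bounded_mfun f ->
  Ex P (fun w => (f w - r) ^+ 2) = cmoment 2 f + (Ex P f - r) ^+ 2.
Proof.
move=> bf; rewrite /cmoment; set m := Ex P f.
rewrite (@eq_Ex _ _ _ _ _ (fun w => (f w - m) ^+ 2 +
  ((2 * (m - r)) * f w + (r ^+ 2 - m ^+ 2)))); last by move=> w; ring.
rewrite ExD ?ExD ?ExZ ?Ex_cst//; bounded.
by rewrite -/m; ring.
Qed.

Lemma Ex_sqr_le f : bounded_mfun f -> Ex P f ^+ 2 <= Ex P (fun w => f w ^+ 2).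
Proof.
move=> bf; rewrite [leRHS](@eq_Ex _ _ _ _ _ (fun w => (f w - 0) ^+ 2)); last first.
  by move=> w; rewrite subr0.
rewrite cmoment2_shift// subr0 lerDr; apply: Ex_ge0 => w; exact: sqr_ge0.
Qed.

(** Two uses of Jensen give [(m - r)^4 <= E (f - r)^4]; then [exprB4_le] yields [16 = 8 + 8]. *)
Lemma cmoment4_shift f (r : R) : bounded_mfun f ->
  cmoment 4 f <= 16 * Ex P (fun w => (f w - r) ^+ 4).
Proof.
move=> bf; rewrite /cmoment; set m := Ex P f.
have H : (m - r) ^+ 4 <= Ex P (fun w => (f w - r) ^+ 4).
  have -> : m - r = Ex P (fun w => f w - r).
    by rewrite ExB ?Ex_cst//; bounded.
  have b1 : bounded_mfun (fun w => f w - r) by bounded.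
  have b2 : bounded_mfun (fun w => (f w - r) ^+ 2) by bounded.
  rewrite [leRHS](@eq_Ex _ _ _ _ _ (fun w => ((f w - r) ^+ 2) ^+ 2)); last first.
    by move=> w; rewrite -exprM.
  apply: le_trans (Ex_sqr_le b2); rewrite -[4%N]/(2 * 2)%N exprM.
  by rewrite ler_sqr ?nnegrE ?sqr_ge0// ?Ex_sqr_le// Ex_ge0// => w; exact: sqr_ge0.
apply: (@le_trans _ _ (Ex P (fun w => 8 * (f w - r) ^+ 4 + 8 * (m - r) ^+ 4))).
  apply: le_Ex; bounded; move=> w.
  have -> : f w - m = (f w - r) - (m - r) by ring.
  by rewrite -mulrDr exprB4_le.
rewrite ExD ?ExZ ?Ex_cst//; bounded.
lra.
Qed.

Section Independent_mean.
Variables (f g : T -> R) (c : R).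
Hypotheses (bf : bounded_mfun f) (bg : bounded_mfun g)
  (fg : independent_pair P f g) (fc : Ex P f = c) (gc : Ex P g = c).

Lemma ExM_centered j k (r s : R) :
  Ex P (fun w => (f w - r) ^+ j * (g w - s) ^+ k) =
  Ex P (fun w => (f w - r) ^+ j) * Ex P (fun w => (g w - s) ^+ k).
Proof.
apply: ExM; [bounded|bounded|].
have m (t : R) n : measurable_fun setT (fun x : R => (x - t) ^+ n).
  by apply: measurable_funX; exact: measurable_funB.
exact: independent_pair_comp (m r j) (m s k) fg.
Qed.

Let centered0 h : bounded_mfun h -> Ex P h = c ->
  Ex P (fun w => (h w - c) ^+ 1) = 0.
Proof.
move=> bh hc; under eq_Ex do rewrite expr1.
by rewrite ExB ?Ex_cst ?hc ?subrr//; bounded.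
Qed.

Lemma mean2_moment2 :
  Ex P (fun w => ((f w + g w) / 2 - c) ^+ 2) = (cmoment 2 f + cmoment 2 g) / 4.
Proof.
rewrite /cmoment fc gc.
rewrite (@eq_Ex _ _ _ _ _ (fun w => 4^-1 * (f w - c) ^+ 2 +
  (4^-1 * (g w - c) ^+ 2 +
   2^-1 * ((f w - c) ^+ 1 * (g w - c) ^+ 1)))); last by move=> w; field.
rewrite !ExD ?ExZ ?ExM_centered ?centered0//; bounded.
by field.
Qed.

Lemma mean2_moment4 :
  Ex P (fun w => ((f w + g w) / 2 - c) ^+ 4) =
  (cmoment 4 f + cmoment 4 g + 6 * cmoment 2 f * cmoment 2 g) / 16.
Proof.
rewrite /cmoment fc gc.
(* First powers are written [^+ 1] so that [ExM_centered] and [centered0] apply; the terms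
   containing one vanish. *)
rewrite (@eq_Ex _ _ _ _ _ (fun w => 16^-1 * (f w - c) ^+ 4 +
  (16^-1 * (g w - c) ^+ 4 + ((6 / 16) * ((f w - c) ^+ 2 * (g w - c) ^+ 2) +
   (4^-1 * ((f w - c) ^+ 3 * (g w - c) ^+ 1) +
    4^-1 * ((f w - c) ^+ 1 * (g w - c) ^+ 3)))))); last by move=> w; field.
rewrite !ExD ?ExZ ?ExM_centered ?centered0//; bounded.
by field.
Qed.

End Independent_mean.

(** The way back from conductance to resistance: [f - 1/c = - (f / c) (1/f - c)], where
    [f / c <= u^2] because [c >= 1/u]. The factor 16 is the price of centering at [1/c]. *)
Lemma cmoment4_inv f (l u : R) : 0 < l -> (forall w, l <= f w <= u) ->
  bounded_mfun f ->
  cmoment 4 f <= 16 * u ^+ 8 * cmoment 4 (fun w => (f w)^-1).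
Proof.
move=> l0 fl bf; set c := Ex P (fun w => (f w)^-1).
have u0 : 0 < u.
  have /andP[h1 h2] := fl point; exact: lt_le_trans l0 (le_trans h1 h2).
have f0 w : 0 < f w by have /andP[h _] := fl w; exact: lt_le_trans h.
have bf' : bounded_mfun (fun w => (f w)^-1).
  by apply: bounded_mfunV l0 _ bf => w; have /andP[] := fl w.
have /andP[cl cu] : u^-1 <= c <= l^-1.
  apply: Ex_bounds => // w; have /andP[h1 h2] := fl w.
  by rewrite !lef_pV2 ?posrE ?h1 ?h2.
have c0 : 0 < c by apply: lt_le_trans cl; rewrite invr_gt0.
rewrite (le_trans (cmoment4_shift c^-1 bf))// -mulrA ler_pM2l// -ExZ; bounded.
apply: le_Ex; bounded => w.
have -> : f w - c^-1 = - (f w / c) * ((f w)^-1 - c).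
  by field; rewrite !gt_eqF.
rewrite exprMn ler_wpM2r//; first by rewrite -[4%N]/(2 * 2)%N exprM sqr_ge0.
have -> : (- (f w / c)) ^+ 4 = (f w / c) ^+ 4 by ring.
have -> : u ^+ 8 = (u ^+ 2) ^+ 4 by rewrite -exprM.
have h0 : 0 <= f w / c by rewrite divr_ge0// ltW.
have h1 : f w / c <= u ^+ 2.
  have /andP[_ h] := fl w; rewrite ler_pdivrMr// expr2 -mulrA.
  have uc : 1 <= u * c by rewrite mulrC -ler_pdivrMr// div1r.
  by rewrite (le_trans h)// ler_peMr// ltW.
by rewrite lerXn2r ?nnegrE// (le_trans h0).
Qed.

End Moments.

(** * Pointwise inequalities *)

Section Real_inequalities.
Set Implicit Arguments. Unset Strict Implicit.
Context {R : realType}.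
Implicit Types (x y z r s : R).

Lemma hmeanE r s : 0 < r -> 0 < s ->
  hmean r s = (r + s) / 2 - (r - s) ^+ 2 / (2 * (r + s)).
Proof. by move=> r0 s0; rewrite /hmean; field; rewrite !gt_eqF ?addr_gt0. Qed.

Lemma hmean_ge0 r s : 0 <= r -> 0 <= s -> 0 <= hmean r s.
Proof. by move=> r0 s0; rewrite divr_ge0 ?addr_ge0 ?invr_ge0. Qed.

Lemma branch_inv x r s : 0 < x -> 0 < r -> 0 < s ->
  (x + hmean r s)^-1 = (r^-1 + s^-1) / 2 / (1 + x * ((r^-1 + s^-1) / 2)).
Proof.
move=> x0 r0 s0; rewrite /hmean.
by field; rewrite !gt_eqF ?addr_gt0 ?mulr_gt0 ?addr_gt0 ?mulr_gt0.
Qed.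

(* conductances contract: [A / (1 + x A)] is 1-Lipschitz in [A] *)
Lemma inv_contraction x mu b A c k : 0 < x <= b -> 0 < mu <= b ->
  0 < A <= k -> 0 <= c <= k ->
  `|A / (1 + x * A) - c / (1 + mu * c)| <= `|A - c| + b * k ^+ 2.
Proof.
move=> /andP[x0 xb] /andP[mu0 mub] /andP[A0 Ak] /andP[c0 ck].
have D1 : 1 <= 1 + x * A by rewrite lerDl mulr_ge0// ltW.
have D2 : 1 <= 1 + mu * c by rewrite lerDl mulr_ge0// ltW.
have E1 : 0 < 1 + x * A := lt_le_trans ltr01 D1.
have E2 : 0 < 1 + mu * c := lt_le_trans ltr01 D2.
have -> : A / (1 + x * A) - c / (1 + mu * c) = ((A - c) + A * c * (mu - x)) /
    ((1 + x * A) * (1 + mu * c)) by field; rewrite !gt_eqF.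
rewrite normrM normfV [`|_ * (1 + mu * c)|]ger0_norm; last first.
  by rewrite mulr_ge0// ltW.
rewrite ler_pdivrMr; last exact: mulr_gt0.
apply: (@le_trans _ _ (`|A - c| + b * k ^+ 2)); last first.
  rewrite ler_peMr ?mulr_ege1// addr_ge0// mulr_ge0 ?sqr_ge0//.
  exact: le_trans (ltW x0) xb.
apply: (le_trans (ler_normD _ _)); rewrite lerD2l normrM.
have h1 : `|A * c| <= k ^+ 2.
  have A0' := ltW A0.
  by rewrite expr2 ger0_norm ?mulr_ge0// ler_pM.
have h2 : `|mu - x| <= b by rewrite ler_norml; apply/andP; split; lra.
by rewrite mulrC ler_pM.
Qed.

(** Young's inequality; the weight 3/2 keeps a contraction, since averaging halves the variance and
    [3/2 * 1/2 = 3/4]. *)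
Lemma sqr_le_split x y z : `|x| <= `|y| + z ->
  x ^+ 2 <= 3 / 2 * y ^+ 2 + 3 * z ^+ 2.
Proof.
move=> h; have h2 : `|x| ^+ 2 <= (`|y| + z) ^+ 2.
  by rewrite ler_sqr ?nnegrE// (le_trans _ h).
rewrite -[x ^+ 2]real_normK ?num_real// -[y ^+ 2]real_normK ?num_real//.
by apply: (le_trans h2); have := sqr_ge0 (`|y| - 2 * z); lra.
Qed.

(** Young's inequality twice: the first pass has weight 9/8, and [(9/8)^2 < 3/2] leaves room for the
    cross term of the second. *)
Lemma expr4_le_split x y z : `|x| <= `|y| + z ->
  x ^+ 4 <= 3 / 2 * y ^+ 4 + 729 * z ^+ 4.
Proof.
have even4 (t : R) : t ^+ 4 = (`|t| ^+ 2) ^+ 2.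
  by rewrite real_normK ?num_real// -exprM.
move=> h; have h2 : `|x| ^+ 2 <= (`|y| + z) ^+ 2.
  by rewrite ler_sqr ?nnegrE// (le_trans _ h).
have h1 : (`|y| + z) ^+ 2 <= 9 / 8 * `|y| ^+ 2 + 9 * z ^+ 2.
  by have := sqr_ge0 (`|y| - 8 * z); lra.
rewrite [x ^+ 4]even4 [y ^+ 4]even4.
have -> : z ^+ 4 = (z ^+ 2) ^+ 2 by rewrite -exprM.
have h3 := le_trans h2 h1; have := sqr_ge0 `|x|; have := sqr_ge0 z.
have := sqr_ge0 `|y|.
move: (`|x| ^+ 2) (`|y| ^+ 2) (z ^+ 2) h3 => p q r pqr q0 r0 p0.
have : p ^+ 2 <= (9 / 8 * q + 9 * r) ^+ 2.
  by rewrite ler_sqr ?nnegrE// (le_trans _ pqr).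
by have := sqr_ge0 (q - 50 * r); have := sqr_ge0 q; have := sqr_ge0 r; lra.
Qed.

Lemma gap_sqr_le r s m l : 0 < l -> l <= r -> l <= s ->
  ((r - s) ^+ 2 / (2 * (r + s))) ^+ 2 <=
  (2 * l ^+ 2)^-1 * (r - m) ^+ 4 + (2 * l ^+ 2)^-1 * (s - m) ^+ 4.
Proof.
move=> l0 lr ls; have S0 : 0 < 2 * (r + s) by lra.
have l20 : 0 < 2 * l ^+ 2 by rewrite mulr_gt0// exprn_gt0.
have := exprB4_le (r - m) (s - m).
have -> : r - m - (s - m) = r - s by ring.
rewrite -mulrDr; move: ((r - m) ^+ 4 + (s - m) ^+ 4) => K h.
have -> : ((r - s) ^+ 2 / (2 * (r + s))) ^+ 2 =
    (r - s) ^+ 4 / (2 * (r + s)) ^+ 2 by field; lra.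
have -> : (2 * l ^+ 2)^-1 * K = 8 * K / (4 * l) ^+ 2 by field; rewrite gt_eqF.
apply: ler_pM => //.
- by rewrite -[4%N]/(2 * 2)%N exprM sqr_ge0.
- by rewrite invr_ge0 sqr_ge0.
- have l4 : 0 < 4 * l by lra.
  by rewrite lef_pV2 ?posrE ?exprn_gt0// ler_sqr ?nnegrE; lra.
Qed.

(** Replacing the denominator [2 (r + s)] by [4 m] costs a multiple of
    [(r - s)^2 (m - (r + s) / 2)]; Young separates it into fourth powers and a squared average,
    whose means are known. *)
Lemma gap_approx r s m l : 0 < l -> l <= r -> l <= s -> l <= m ->
  `|(r - s) ^+ 2 / (2 * (r + s)) - (4 * m)^-1 * (r - s) ^+ 2| <=
  (2 * l ^+ 2)^-1 * (r - m) ^+ 4 + (2 * l ^+ 2)^-1 * (s - m) ^+ 4 +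
  (4 * l ^+ 2)^-1 * ((r + s) / 2 - m) ^+ 2.
Proof.
move=> l0 lr ls lm; have S0 : 0 < r + s by lra.
have m0 : 0 < m := lt_le_trans l0 lm.
have l20 : 0 < l ^+ 2 by rewrite exprn_gt0.
have -> : (r - s) ^+ 2 / (2 * (r + s)) - (4 * m)^-1 * (r - s) ^+ 2 =
  ((r - s) ^+ 2 * (m - (r + s) / 2)) / (2 * m * (r + s)).
  by field; rewrite !gt_eqF.
have := exprB4_le (r - m) (s - m).
have -> : r - m - (s - m) = r - s by ring.
rewrite -mulrDr; move: ((r - m) ^+ 4 + (s - m) ^+ 4) => K.
have -> : (r - s) ^+ 4 = ((r - s) ^+ 2) ^+ 2 by rewrite -exprM.
have -> : ((r + s) / 2 - m) ^+ 2 = (m - (r + s) / 2) ^+ 2 by ring.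
have lS : 4 * l ^+ 2 <= 2 * m * (r + s).
  have : l * l <= m * ((r + s) / 2) by rewrite ler_pM//; lra.
  by rewrite expr2; lra.
move: ((r - s) ^+ 2) (m - (r + s) / 2) => D y h.
rewrite normrM normfV [`|2 * _ * _|]gtr0_norm ?mulr_gt0//.
apply: (@le_trans _ _ (`|D * y| / (4 * l ^+ 2))).
  by rewrite ler_wpM2l// lef_pV2 ?posrE ?mulr_gt0.
have -> : (2 * l ^+ 2)^-1 * K + (4 * l ^+ 2)^-1 * y ^+ 2 =
    (2 * K + y ^+ 2) / (4 * l ^+ 2) by field; rewrite gt_eqF.
apply: ler_wpM2r; first by rewrite invr_ge0 mulr_ge0// ltW.
rewrite ler_norml.
by have := sqr_ge0 (D - 2 * y); have := sqr_ge0 (D + 2 * y) => *;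
  apply/andP; split; lra.
Qed.

(** Young's inequality on the cross term [2 z q], with the weight left free until the sizes of [z]
    and [q] are known. *)
Lemma sqrB_approx z q t : 0 < t ->
  (1 - t) * z ^+ 2 - t^-1 * q ^+ 2 <= (z - q) ^+ 2 /\
  (z - q) ^+ 2 <= (1 + t) * z ^+ 2 + (1 + t^-1) * q ^+ 2.
Proof.
move=> t0; have ti : 0 < t^-1 by rewrite invr_gt0.
have E : t * t^-1 = 1 by rewrite divff// gt_eqF.
have h1 : 0 <= t * (z - t^-1 * q) ^+ 2 by rewrite mulr_ge0 ?sqr_ge0// ltW.
have h2 : 0 <= t * (z + t^-1 * q) ^+ 2 by rewrite mulr_ge0 ?sqr_ge0// ltW.
have E1 : t * (z - t^-1 * q) ^+ 2 = t * z ^+ 2 - 2 * z * q + t^-1 * q ^+ 2.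
  by field; rewrite gt_eqF.
have E2 : t * (z + t^-1 * q) ^+ 2 = t * z ^+ 2 + 2 * z * q + t^-1 * q ^+ 2.
  by field; rewrite gt_eqF.
have := sqr_ge0 q; split; nra.
Qed.

Lemma inv_approx z m l : 0 < l -> l <= z -> l <= m ->
  - (z - m) / m ^+ 2 <= z^-1 - m^-1 /\
  z^-1 - m^-1 <= - (z - m) / m ^+ 2 + (l ^+ 3)^-1 * (z - m) ^+ 2.
Proof.
move=> l0 lz lm; have z0 := lt_le_trans l0 lz; have m0 := lt_le_trans l0 lm.
have -> : z^-1 - m^-1 = - (z - m) / m ^+ 2 + (m ^+ 2 * z)^-1 * (z - m) ^+ 2.
  by field; rewrite !gt_eqF.
rewrite lerDl lerD2l; split.
  by rewrite mulr_ge0 ?sqr_ge0// invr_ge0 mulr_ge0 ?sqr_ge0// ltW.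
rewrite ler_wpM2r ?sqr_ge0// lef_pV2 ?posrE ?mulr_gt0 ?exprn_gt0//.
have h : l ^+ 2 <= m ^+ 2 by rewrite ler_sqr ?nnegrE// ltW.
by rewrite exprSr; exact: ler_pM (sqr_ge0 l) (ltW l0) h lz.
Qed.

End Real_inequalities.

(** * Moment inequalities across one level *)

Section One_level.
Set Implicit Arguments. Unset Strict Implicit.
Context {d : measure_display} {T : measurableType d} {R : realType}
  (P : probability T R).
Variables (X U V : T -> R) (a b l u : R).
Hypotheses (a0 : 0 < a) (l0 : 0 < l)
  (Xab : forall w, a <= X w <= b)
  (Ulu : forall w, l <= U w <= u) (Vlu : forall w, l <= V w <= u)
  (bX : bounded_mfun X) (bU : bounded_mfun U) (bV : bounded_mfun V)
  (UV : independent_pair P U V) (XU : independent_pair P X U)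
  (XV : independent_pair P X V)
  (eq_inv1 : Ex P (fun w => (V w)^-1) = Ex P (fun w => (U w)^-1))
  (eq_inv2 : cmoment P 2 (fun w => (V w)^-1) = cmoment P 2 (fun w => (U w)^-1))
  (eq_inv4 : cmoment P 4 (fun w => (V w)^-1) = cmoment P 4 (fun w => (U w)^-1))
  (eq1 : Ex P V = Ex P U)
  (eq2 : cmoment P 2 V = cmoment P 2 U)
  (eq4 : cmoment P 4 V = cmoment P 4 U).

Let Z w := X w + hmean (U w) (V w).
Let A w := ((U w)^-1 + (V w)^-1) / 2.
Let Q w := (U w - V w) ^+ 2 / (2 * (U w + V w)).
Let mu := Ex P X.
Let m := Ex P U.
Let c := Ex P (fun w => (U w)^-1).
Let c' := Ex P (fun w => (Z w)^-1).
(* the conductance of one level in which both random inputs are frozen at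
   their means *)
Let phi := c / (1 + mu * c).
(** The freezing error of [inv_contraction] for conductances at most [l^-1]. *)
Let kappa := b * l^-1 ^+ 2.

Let U0 w : 0 < U w. Proof. by have /andP[h _] := Ulu w; exact: lt_le_trans h. Qed.
Let V0 w : 0 < V w. Proof. by have /andP[h _] := Vlu w; exact: lt_le_trans h. Qed.
Let X0 w : 0 < X w. Proof. by have /andP[h _] := Xab w; exact: lt_le_trans h. Qed.

Let lU w : l <= U w. Proof. by have /andP[] := Ulu w. Qed.
Let lV w : l <= V w. Proof. by have /andP[] := Vlu w. Qed.

Let biU : bounded_mfun (fun w => (U w)^-1).
Proof. exact: bounded_mfunV l0 lU bU. Qed.

Let biV : bounded_mfun (fun w => (V w)^-1).
Proof. exact: bounded_mfunV l0 lV bV. Qed.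

Let bA : bounded_mfun A. Proof. by rewrite /A; bounded. Qed.

Let ZE w : Z w = X w + ((U w + V w) / 2 - Q w).
Proof. by rewrite /Z hmeanE. Qed.

Let bQ : bounded_mfun Q.
Proof.
rewrite /Q; bounded; apply: (bounded_mfunV l0); bounded.
by move=> w; have := lU w; have := lV w; move: l0; lra.
Qed.

Let bZ : bounded_mfun Z.
Proof. by rewrite (funext ZE : Z = _); bounded. Qed.

Let Z_ge w : a <= Z w.
Proof.
have /andP[h _] := Xab w; apply: (le_trans h); rewrite lerDl.
exact: hmean_ge0 (ltW (U0 w)) (ltW (V0 w)).
Qed.

Let biZ : bounded_mfun (fun w => (Z w)^-1).
Proof. exact: bounded_mfunV a0 Z_ge bZ. Qed.

Let iU_bounds w : 0 < (U w)^-1 <= l^-1.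
Proof. by rewrite invr_gt0 U0/= lef_pV2 ?posrE. Qed.

Let iV_bounds w : 0 < (V w)^-1 <= l^-1.
Proof. by rewrite invr_gt0 V0/= lef_pV2 ?posrE. Qed.

Let A_bounds w : 0 < A w <= l^-1.
Proof.
have /andP[h1 h2] := iU_bounds w; have /andP[h3 h4] := iV_bounds w.
by rewrite /A; apply/andP; split; lra.
Qed.

Let c_bounds : 0 <= c <= l^-1.
Proof.
apply: (Ex_bounds P biU) => w; have /andP[h1 h2] := iU_bounds w.
by rewrite (ltW h1) h2.
Qed.

Let mu_bounds : 0 < mu <= b.
Proof.
have /andP[h1 h2] := Ex_bounds P bX Xab.
by rewrite (lt_le_trans a0 h1).
Qed.

Let invZ_phi w : `|(Z w)^-1 - phi| <= `|A w - c| + kappa.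
Proof.
have /andP[_ xb] := Xab w; rewrite (branch_inv (X0 w) (U0 w) (V0 w)).
by apply: inv_contraction (A_bounds w) c_bounds; rewrite ?X0.
Qed.

Let iUV : independent_pair P (fun w => (U w)^-1) (fun w => (V w)^-1).
Proof.
have mi : measurable_fun setT (fun x : R => x `^ (-1)) by exact: measurable_powR.
have -> : (fun w => (U w)^-1) = (fun x : R => x `^ (-1)) \o U.
  by apply/funext => w; exact: esym (powR_inv1 (ltW (U0 w))).
have -> : (fun w => (V w)^-1) = (fun x : R => x `^ (-1)) \o V.
  by apply/funext => w; exact: esym (powR_inv1 (ltW (V0 w))).
exact: (independent_pair_comp mi mi UV).
Qed.

Let Ex_A2 : Ex P (fun w => (A w - c) ^+ 2) =
  cmoment P 2 (fun w => (U w)^-1) / 2.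
Proof.
by rewrite (mean2_moment2 biU biV iUV erefl eq_inv1) eq_inv2; field.
Qed.

Let Ex_A4 : Ex P (fun w => (A w - c) ^+ 4) =
  (cmoment P 4 (fun w => (U w)^-1) +
   3 * cmoment P 2 (fun w => (U w)^-1) ^+ 2) / 8.
Proof.
by rewrite (mean2_moment4 biU biV iUV erefl eq_inv1) eq_inv2 eq_inv4; field.
Qed.

(** The second moment is taken about [phi], not about the mean. The resulting bias term
    [(c' - phi) ^+ 2] is kept because [inv_moment4_step] needs a bound on it. *)
Lemma inv_moment2_step :
  cmoment P 2 (fun w => (Z w)^-1) + (c' - phi) ^+ 2 <=
  3 / 4 * cmoment P 2 (fun w => (U w)^-1) + 3 * kappa ^+ 2.
Proof.
rewrite -(cmoment2_shift P phi biZ).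
apply: (@le_trans _ _
  (Ex P (fun w => 3 / 2 * (A w - c) ^+ 2 + 3 * kappa ^+ 2))).
  by apply: le_Ex; bounded => w; exact: sqr_le_split (invZ_phi w).
rewrite ExD ?Ex_cst ?ExZ ?Ex_A2; bounded; lra.
Qed.

(** Recentering from [phi] to [c'] enlarges the error from [kappa] to [kappa + |c' - phi|];
    [5832 = 729 * 8] combines [expr4_le_split] with [exprB4_le]. *)
Lemma inv_moment4_step :
  cmoment P 4 (fun w => (Z w)^-1) <=
  3 / 16 * (cmoment P 4 (fun w => (U w)^-1) +
            3 * cmoment P 2 (fun w => (U w)^-1) ^+ 2) +
  5832 * (kappa ^+ 4 + (c' - phi) ^+ 4).
Proof.
have even4 (t : R) : t ^+ 4 = `|t| ^+ 4.
  rewrite -normrX ger0_norm; first by [].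
  by rewrite -[4%N]/(2 * 2)%N exprM; exact: sqr_ge0.
set rho := (kappa + `|c' - phi|) ^+ 4.
have rho_le : rho <= 8 * (kappa ^+ 4 + (c' - phi) ^+ 4).
  have := exprB4_le kappa (- `|c' - phi|); rewrite opprK -/rho.
  have -> : (- `|c' - phi|) ^+ 4 = `|c' - phi| ^+ 4 by ring.
  by rewrite -even4.
apply: (@le_trans _ _ (Ex P (fun w => 3 / 2 * (A w - c) ^+ 4 + 729 * rho))).
  apply: le_Ex; bounded => w; apply: expr4_le_split.
  have -> : (Z w)^-1 - c' = ((Z w)^-1 - phi) - (c' - phi) by ring.
  apply: (le_trans (ler_normB _ _)); rewrite addrA lerD2r; exact: invZ_phi.
rewrite ExD ?Ex_cst ?ExZ ?Ex_A4; bounded; lra.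
Qed.

Let m_ge : l <= m.
Proof. by have /andP[] := Ex_bounds P bU Ulu. Qed.

Let sigma2 := cmoment P 2 X.
Let var := cmoment P 2 U.
Let M4 := cmoment P 4 U.

Let EX2 : Ex P (fun w => (X w - mu) ^+ 2) = sigma2. Proof. reflexivity. Qed.

Let EU2 : Ex P (fun w => (U w - m) ^+ 2) = var. Proof. reflexivity. Qed.

Let EU4 : Ex P (fun w => (U w - m) ^+ 4) = M4. Proof. reflexivity. Qed.

Let EV2 : Ex P (fun w => (V w - m) ^+ 2) = var.
Proof. rewrite -[RHS]eq2 /cmoment eq1; reflexivity. Qed.

Let EV4 : Ex P (fun w => (V w - m) ^+ 4) = M4.
Proof. rewrite -[RHS]eq4 /cmoment eq1; reflexivity. Qed.

Let EX1 : Ex P (fun w => (X w - mu) ^+ 1) = 0.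
Proof. by under eq_Ex do rewrite expr1; rewrite ExB ?Ex_cst ?subrr; bounded. Qed.

Let EU1 : Ex P (fun w => (U w - m) ^+ 1) = 0.
Proof. by under eq_Ex do rewrite expr1; rewrite ExB ?Ex_cst ?subrr; bounded. Qed.

Let Ex_Q2 : Ex P (fun w => Q w ^+ 2) <= M4 / l ^+ 2.
Proof.
apply: (@le_trans _ _ (Ex P (fun w => (2 * l ^+ 2)^-1 * (U w - m) ^+ 4 +
    (2 * l ^+ 2)^-1 * (V w - m) ^+ 4))).
  by apply: le_Ex; bounded => w; exact: gap_sqr_le.
rewrite ExD ?ExZ; bounded; rewrite EU4 EV4.
by rewrite le_eqVlt; apply/orP; left; apply/eqP; field; rewrite gt_eqF.
Qed.

Lemma Ex_step : Ex P Z = mu + m - Ex P Q.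
Proof.
rewrite (funext ZE : Z = _) ExD ?ExB; bounded.
have -> : Ex P (fun w => (U w + V w) / 2) = m; last by rewrite addrA.
rewrite (@eq_Ex _ _ _ _ _ (fun w => 2^-1 * U w + 2^-1 * V w)).
  by rewrite ExD ?ExZ; bounded; rewrite eq1 -/m; field.
by move=> w; field.
Qed.

(** By independence [E (U - V)^2 = 2 var], so [var / (2 m)] is the mean of the approximant in
    [gap_approx]. *)
Lemma Ex_gap : `|Ex P Q - var / (2 * m)| <= (M4 + var / 8) / l ^+ 2.
Proof.
have m0 : 0 < m := lt_le_trans l0 m_ge.
have -> : var / (2 * m) = Ex P (fun w => (4 * m)^-1 * (U w - V w) ^+ 2).
  rewrite ExZ; bounded.
  rewrite (@eq_Ex _ _ _ _ _ (fun w => (U w - m) ^+ 2 + ((V w - m) ^+ 2 +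
    (-2) * ((U w - m) ^+ 1 * (V w - m) ^+ 1)))); last by move=> w; ring.
  rewrite !ExD ?ExZ; bounded.
  rewrite (ExM_centered bU bV UV) EU1 EU2 EV2.
  by rewrite mul0r mulr0 addr0; field; rewrite gt_eqF.
pose B w := (2 * l ^+ 2)^-1 * (U w - m) ^+ 4 +
  (2 * l ^+ 2)^-1 * (V w - m) ^+ 4 +
  (4 * l ^+ 2)^-1 * ((U w + V w) / 2 - m) ^+ 2.
have bB : bounded_mfun B by rewrite /B; bounded.
have ExB' : Ex P B = (M4 + var / 8) / l ^+ 2.
  rewrite /B !ExD ?ExZ; bounded; rewrite EU4 EV4.
  rewrite (mean2_moment2 bU bV UV erefl eq1) eq2 -/var.
  by field; rewrite gt_eqF.
have QB w := gap_approx l0 (lU w) (lV w) m_ge.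
rewrite -ExB; bounded; rewrite -ExB' ler_norml; apply/andP; split.
  rewrite -mulN1r -ExZ; bounded; apply: le_Ex; bounded => w.
  by rewrite mulN1r; have := QB w; rewrite ler_norml => /andP[].
apply: le_Ex; bounded => w.
by have := QB w; rewrite ler_norml => /andP[].
Qed.

(** The centered [Z] is [S - q]: [S] is the linear part, of variance [sigma2 + var / 2] by
    independence, and [q] is the centered gap, with second moment at most that of [Q]. *)
Lemma moment2_step t : 0 < t ->
  `|cmoment P 2 Z - (sigma2 + var / 2)| <=
  t * (sigma2 + var / 2) + (1 + t^-1) * (M4 / l ^+ 2).
Proof.
move=> t0; have ti : 0 < t^-1 by rewrite invr_gt0.
pose S w := (X w - mu) + ((U w + V w) / 2 - m).
pose q w := Q w - Ex P Q.
have bS : bounded_mfun S by rewrite /S; bounded.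
have bq : bounded_mfun q by rewrite /q; bounded.
have -> : cmoment P 2 Z = Ex P (fun w => (S w - q w) ^+ 2).
  apply: eq_Ex => w; congr (_ ^+ 2); rewrite Ex_step ZE /S /q; ring.
have Eq : Ex P (fun w => q w ^+ 2) <= M4 / l ^+ 2.
  apply: le_trans Ex_Q2; have := cmoment2_shift P 0 bQ.
  rewrite subr0 => h; have -> : Ex P (fun w => Q w ^+ 2) =
    Ex P (fun w => (Q w - 0) ^+ 2) by apply: eq_Ex => w; rewrite subr0.
  by rewrite h lerDl sqr_ge0.
have Eq0 : 0 <= Ex P (fun w => q w ^+ 2).
  by apply: Ex_ge0 => w; exact: sqr_ge0.
have ES : Ex P (fun w => S w ^+ 2) = sigma2 + var / 2.
  rewrite (@eq_Ex _ _ _ _ _ (fun w => (X w - mu) ^+ 2 +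
    (((U w + V w) / 2 - m) ^+ 2 + ((X w - mu) ^+ 1 * (U w - m) ^+ 1 +
     (X w - mu) ^+ 1 * (V w - m) ^+ 1)))); last by move=> w; rewrite /S; field.
  rewrite !ExD; bounded.
  rewrite (ExM_centered bX bU XU) (ExM_centered bX bV XV).
  rewrite EX1 EX2 (mean2_moment2 bU bV UV erefl eq1) eq2 -/var.
  by rewrite !mul0r !addr0; field.
have lo : Ex P (fun w => (1 - t) * S w ^+ 2 + (- t^-1) * q w ^+ 2) <=
    Ex P (fun w => (S w - q w) ^+ 2).
  apply: le_Ex; bounded => w; rewrite mulNr.
  by have [] := sqrB_approx (S w) (q w) t0.
have hi : Ex P (fun w => (S w - q w) ^+ 2) <=
    Ex P (fun w => (1 + t) * S w ^+ 2 + (1 + t^-1) * q w ^+ 2).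
  apply: le_Ex; bounded => w.
  by have [] := sqrB_approx (S w) (q w) t0.
move: lo hi; rewrite !ExD ?ExZ; bounded; rewrite ES.
move: (Ex P (fun w => q w ^+ 2)) Eq0 Eq => e e0 eM.
have h1 : t^-1 * e <= t^-1 * (M4 / l ^+ 2) by rewrite ler_pM2l.
have h2 : 0 <= t^-1 * e := mulr_ge0 (ltW ti) e0.
rewrite ler_norml => lo hi; apply/andP; split; lra.
Qed.

End One_level.

(** Second-order expansion of the inverse at the mean, whose linear term integrates to 0. *)
Lemma Ex_inv_approx {d : measure_display} {T : measurableType d} {R : realType}
    (P : probability T R) (f : T -> R) (l : R) :
  0 < l -> (forall w, l <= f w) -> bounded_mfun f ->
  `|Ex P (fun w => (f w)^-1) - (Ex P f)^-1| <= cmoment P 2 f / l ^+ 3.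
Proof.
move=> l0 lf bf; set m := Ex P f.
have lm : l <= m by rewrite -(Ex_cst P l); apply: le_Ex; bounded.
have bi : bounded_mfun (fun w => (f w)^-1) by exact: bounded_mfunV l0 lf bf.
have E1 : Ex P (fun w => - (m ^+ 2)^-1 * (f w - m)) = 0.
  by rewrite ExZ ?ExB ?Ex_cst ?subrr ?mulr0; bounded.
have -> : Ex P (fun w => (f w)^-1) - m^-1 = Ex P (fun w => (f w)^-1 - m^-1).
  by rewrite ExB ?Ex_cst; bounded.
have H w := inv_approx l0 (lf w) lm.
have h1 : 0 <= Ex P (fun w => (f w)^-1 - m^-1).
  rewrite -E1; apply: le_Ex; bounded => w; have [+ _] := H w.
  by rewrite mulrC mulrN mulNr.
rewrite ger0_norm//.
apply: (@le_trans _ _ (Ex P (fun w => - (m ^+ 2)^-1 * (f w - m) +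
    (l ^+ 3)^-1 * (f w - m) ^+ 2))).
  apply: le_Ex; bounded => w; have [_] := H w.
  by rewrite [in X in _ <= X -> _]mulrC mulrN mulNr.
by rewrite ExD ?E1 ?add0r ?ExZ; bounded; rewrite mulrC.
Qed.

(** * Recursive inequalities and logarithms *)

Section Asymptotics.
Set Implicit Arguments. Unset Strict Implicit.
Context {R : realType}.
Implicit Types (u : nat -> R).

Local Notation inv n := (n%:R^-1 : R).

Let inv_gt0 n : (0 < n)%N -> 0 < inv n.
Proof. by move=> n0; rewrite invr_gt0 ltr0n. Qed.

Let inv_le1 n : (0 < n)%N -> inv n <= 1.
Proof. by move=> n0; rewrite invf_le1 ?ltr0n// ler1n. Qed.

(** Bernoulli's inequality for [(1 - 1/(n+1))^j] with denominators cleared. *)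
Lemma bernoulli_succ (n j : nat) :
  n.+1%:R ^+ j * (n.+1%:R - j%:R) <= n%:R ^+ j * n.+1%:R :> R.
Proof.
elim: j => [|j IH]; first by rewrite !expr0 !mul1r subr0.
rewrite [_ ^+ j.+1]exprS [n%:R ^+ j.+1]exprS -[n%:R * _ * _]mulrA.
apply: (@le_trans _ _ (n%:R * (n.+1%:R ^+ j * (n.+1%:R - j%:R)))); last first.
  exact: ler_wpM2l.
rewrite [leLHS](_ : _ = n.+1%:R ^+ j * (n.+1%:R * (n.+1%:R - j.+1%:R))); last by ring.
rewrite [leRHS](_ : _ = n.+1%:R ^+ j * (n%:R * (n.+1%:R - j%:R))); last by ring.
rewrite ler_wpM2l ?exprn_ge0// -!natr1.
by have : 0 <= j%:R :> R by []; move: (n%:R : R) (j%:R : R) => x y; lra.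
Qed.

Lemma contraction_decay (p : nat) (U K : R) : 0 <= U -> 0 <= K ->
  exists2 L : R, 0 <= L & forall u,
    (forall n, (0 < n)%N -> u n <= U) ->
    (forall n, (0 < n)%N -> u n.+1 <= 3 / 4 * u n + K * inv n ^+ p) ->
    forall n, (0 < n)%N -> u n <= L * inv n ^+ p.
Proof.
(* Beyond [N], Bernoulli gives [(n / (n+1))^p >= 7/8 = 3/4 + 1/8], and the 1/8 absorbs [K] because
   [L >= 8 K]. Up to [N] the trivial bound [U] suffices, as [L >= U N^p]. *)
move=> U0 K0; pose N := (8 * p).+1.
pose L := 8 * K + U * N%:R ^+ p.
have L0 : 0 <= L by rewrite addr_ge0 ?mulr_ge0 ?exprn_ge0.
exists L => // u uU uK.
have small n : (0 < n <= N)%N -> u n <= L * inv n ^+ p.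
  move=> /andP[n0 nN]; rewrite (le_trans (uU n n0))//.
  have h : 1 <= N%:R ^+ p * inv n ^+ p :> R.
    rewrite -exprMn exprn_ege1// ler_pdivlMr ?ltr0n// mul1r ler_nat//.
  have i0 : 0 <= inv n ^+ p :> R by rewrite exprn_ge0// ltW// inv_gt0.
  have -> : L * inv n ^+ p = 8 * K * inv n ^+ p + U * (N%:R ^+ p * inv n ^+ p).
    by rewrite /L; ring.
  by apply: (le_trans (ler_peMr U0 h)); rewrite lerDr !mulr_ge0.
elim=> // n IH _; have [nN|nN] := leqP n.+1 N; first exact: small.
have n0 : (0 < n)%N by lia.
rewrite (le_trans (uK n n0))//.
have r0 := inv_gt0 n0; have s0 : 0 < inv n.+1 := inv_gt0 (ltn0Sn n).
have ratio : 7 / 8 * inv n ^+ p <= inv n.+1 ^+ p :> R.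
  have x0 : 0 < n%:R ^+ p :> R by rewrite exprn_gt0// ltr0n.
  have y0 : 0 < n.+1%:R ^+ p :> R by rewrite exprn_gt0// ltr0n.
  rewrite !exprVn ler_pdivrMr// [leRHS]mulrC ler_pdivlMr//.
  have h := bernoulli_succ n p.
  have hp : 8 * p%:R <= n.+1%:R :> R by rewrite -natrM ler_nat; lia.
  have n1 : 0 < n.+1%:R :> R by rewrite ltr0n.
  rewrite -(ler_pM2r n1) (le_trans _ h)//.
  rewrite mulrAC [leLHS]mulrC ler_pM2l//; lra.
have LK : 8 * K <= L by rewrite lerDl mulr_ge0// exprn_ge0.
have q0 : 0 <= inv n ^+ p :> R by rewrite exprn_ge0// ltW.
apply: (@le_trans _ _ (L * (7 / 8 * inv n ^+ p))); last by rewrite ler_wpM2l.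
have := IH n0; have : 8 * K * inv n ^+ p <= L * inv n ^+ p by rewrite ler_wpM2r.
lra.
Qed.

(** From [ln n = 2 ln (sqrt n)] and sublinearity of the logarithm. *)
Lemma ln_sqr_le (n : nat) : (0 < n)%N -> ln n%:R ^+ 2 <= 4 * n%:R :> R.
Proof.
move=> n0; have x0 : 0 < n%:R :> R by rewrite ltr0n.
have s0 : 0 < Num.sqrt (n%:R : R) by rewrite sqrtr_gt0.
have E : n%:R = Num.sqrt (n%:R : R) ^+ 2 by rewrite sqr_sqrtr// ltW.
have -> : ln (n%:R : R) = 2 * ln (Num.sqrt (n%:R : R)).
  by rewrite [in LHS]E lnXn// mulr_natl.
rewrite [in leRHS]E exprMn.
have l0 : 0 <= ln (Num.sqrt (n%:R : R)).
  by rewrite ln_ge0// -[leLHS]sqrtr1 ler_wsqrtr// ler1n.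
have -> : 2 ^+ 2 = 4 :> R by ring.
by rewrite ler_pM2l// ler_sqr ?nnegrE ?(ltW s0)// ltW// ln_sublinear.
Qed.

Lemma ln_ratio_bounds (x y : R) : 0 < x -> 0 < y ->
  (x - y) / x <= ln x - ln y <= (x - y) / y.
Proof.
have H z t : 0 < z -> 0 < t -> ln z - ln t <= (z - t) / t :> R.
  move=> z0 t0; rewrite -ln_div ?posrE//.
  have -> : z / t = 1 + (z - t) / t by field; rewrite gt_eqF.
  apply: le_ln1Dx; have : 0 < z / t by rewrite divr_gt0.
  have -> : z / t = 1 + (z - t) / t by field; rewrite gt_eqF.
  lra.
move=> x0 y0; rewrite H// andbT; have := H y x y0 x0.
have -> : (y - x) / x = - ((x - y) / x) by ring.
lra.
Qed.

Lemma summable_increments u (K : R) : 0 <= K ->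
  (forall n, (0 < n)%N -> `|u n.+1 - u n| <= K * inv n ^+ 2) ->
  forall n, (0 < n)%N -> `|u n - u 1%N| <= 2 * K.
Proof.
move=> K0 uK n n0.
(* The strengthened bound telescopes, by [1/n^2 <= 2 (1/n - 1/(n+1))]. *)
suff H : `|u n - u 1%N| <= 2 * K * (1 - inv n).
  by apply: (le_trans H); have := mulr_ge0 K0 (ltW (inv_gt0 n0)); lra.
elim: n n0 => // -[|n] IH _; first by rewrite invr1 !subrr normr0 mulr0.
have -> : u n.+2 - u 1%N = (u n.+2 - u n.+1) + (u n.+1 - u 1%N) by ring.
apply: (le_trans (ler_normD _ _)).
have := uK n.+1 (ltn0Sn n); have := IH (ltn0Sn n).
have h : inv n.+1 ^+ 2 <= 2 * (inv n.+1 - inv n.+2).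
  have z : 1 <= n.+1%:R :> R by rewrite ler1n.
  rewrite -[n.+2%:R]natr1; move: (n.+1%:R : R) z => x x1.
  have -> : 2 * (x^-1 - (x + 1)^-1) = 2 / (x * (x + 1)).
    by field; rewrite !gt_eqF; lra.
  have xx : 0 < x * (x + 1) by rewrite mulr_gt0; lra.
  have x2 : 0 < x ^+ 2 by rewrite exprn_gt0//; lra.
  rewrite exprVn ler_pdivlMr// [leLHS]mulrC ler_pdivrMr// expr2.
  have : 0 <= x * (x - 1) by apply: mulr_ge0; lra.
  lra.
have := ler_wpM2l K0 h.
move: (inv n.+1) (inv n.+2) (u n.+2 - u n.+1) (u n.+1 - u 1%N) => x y v w.
lra.
Qed.

End Asymptotics.

(** * Asymptotics of moment profiles *)

Section Profile.
Set Implicit Arguments. Unset Strict Implicit.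
Context {R : realType} (a b : R).
Hypotheses (a0 : 0 < a) (ab : a < b).

Local Notation inv n := (n%:R^-1 : R).

(* The recursive inequalities between the moments of the resistance [Z_n] of
   [T_n]: [w2 n], [w4 n] are the central moments of [1 / Z_n] and [c n] its mean,
   [V n], [M n] are the central moments of [Z_n] and [m n] its mean.  The
   auxiliary [phi n] is the conductance of one level whose inputs are frozen at
   their means, and [q n] is the mean of [(U - V)^2 / (2 (U + V))] for two
   independent copies [U], [V] of [Z_n]. *)
Record moment_profile (mu s : R) (w2 w4 V M m c phi q : nat -> R) : Prop := {
  mu_itv : a <= mu <= b;
  s_itv : 0 <= s <= b ^+ 2;
  w2_itv : forall n, (0 < n)%N -> 0 <= w2 n <= (a^-1) ^+ 2;
  w4_itv : forall n, (0 < n)%N -> 0 <= w4 n <= (a^-1) ^+ 4;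
  V_itv : forall n, (0 < n)%N -> 0 <= V n /\ V n ^+ 2 <= M n;
  m_itv : forall n, (0 < n)%N -> a * n%:R <= m n <= b * n%:R;
  w2_step : forall n, (0 < n)%N ->
    w2 n.+1 + (c n.+1 - phi n) ^+ 2 <=
    3 / 4 * w2 n + 3 * (b * (a * n%:R)^-1 ^+ 2) ^+ 2;
  w4_step : forall n, (0 < n)%N ->
    w4 n.+1 <= 3 / 16 * (w4 n + 3 * w2 n ^+ 2) +
    5832 * ((b * (a * n%:R)^-1 ^+ 2) ^+ 4 + (c n.+1 - phi n) ^+ 4);
  M_w4 : forall n, (0 < n)%N -> M n <= 16 * (b * n%:R) ^+ 8 * w4 n;
  V_step : forall n t, (0 < n)%N -> 0 < t ->
    `|V n.+1 - (s + V n / 2)| <=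
    t * (s + V n / 2) + (1 + t^-1) * (M n / (a * n%:R) ^+ 2);
  m_step : forall n, (0 < n)%N -> m n.+1 = mu + m n - q n;
  q_gap : forall n, (0 < n)%N ->
    `|q n - V n / (2 * m n)| <= (M n + V n / 8) / (a * n%:R) ^+ 2;
  c_inv : forall n, (0 < n)%N -> `|c n - (m n)^-1| <= V n / (a * n%:R) ^+ 3 }.

Let b0 : 0 < b := lt_trans a0 ab.
Let ai0 : 0 < a^-1. Proof. by rewrite invr_gt0. Qed.

Let nat_gt0 n : (0 < n)%N -> 0 < n%:R :> R. Proof. by rewrite ltr0n. Qed.

Let inv_gt0 n : (0 < n)%N -> 0 < inv n.
Proof. by move=> n0; rewrite invr_gt0 ltr0n. Qed.

Let inv_le1 n : (0 < n)%N -> inv n <= 1.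
Proof. by move=> n0; rewrite invf_le1 ?ltr0n// ler1n. Qed.

Lemma profile_M_bounded : exists2 K : R, 0 <= K &
  forall mu s w2 w4 V M m c phi q, moment_profile mu s w2 w4 V M m c phi q ->
  forall n, (0 < n)%N -> M n <= K.
Proof.
pose k := b * a^-1 ^+ 2.
have kE n : b * (a * n%:R)^-1 ^+ 2 = k * inv n ^+ 2 by rewrite /k invfM; ring.
have K20 : 0 <= 3 * k ^+ 2 by rewrite mulr_ge0 ?sqr_ge0.
have [L2 L20 H2] := contraction_decay 4 (sqr_ge0 a^-1) K20.
(* Discarding the nonnegative [w2 n.+1] in [w2_step] bounds the squared bias by [D / n^4]. *)
pose D := 3 / 4 * L2 + 3 * k ^+ 2.
have D0 : 0 <= D by rewrite addr_ge0// mulr_ge0// divr_ge0.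
pose K4 := 9 / 16 * L2 ^+ 2 + 5832 * (k ^+ 4 + D ^+ 2).
have k40 : 0 <= k ^+ 4 by rewrite exprn_ge0// mulr_ge0 ?sqr_ge0// ltW.
have K40 : 0 <= K4.
  by have := sqr_ge0 D; have := sqr_ge0 L2; rewrite /K4; lra.
have A4 : 0 <= (a^-1) ^+ 4 := exprn_ge0 4 (ltW ai0).
have [L4 L40 H4] := contraction_decay 8 A4 K40.
exists (16 * b ^+ 8 * L4); first by rewrite !mulr_ge0// ?exprn_ge0// ltW.
move=> mu s w2 w4 V M m c phi q pr.
have w2L n : (0 < n)%N -> w2 n <= L2 * inv n ^+ 4.
  apply: (H2 w2) => {}n n0; first by have /andP[] := w2_itv pr n0.
  have := w2_step pr n0; rewrite kE; have := sqr_ge0 (c n.+1 - phi n).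
  have -> : 3 * (k * inv n ^+ 2) ^+ 2 = 3 * k ^+ 2 * inv n ^+ 4 by ring.
  lra.
have dD n : (0 < n)%N -> (c n.+1 - phi n) ^+ 2 <= D * inv n ^+ 4.
  move=> n0; have := w2_step pr n0; rewrite kE; have := w2L n n0.
  have /andP[+ _] := w2_itv pr (ltn0Sn n).
  have -> : 3 * (k * inv n ^+ 2) ^+ 2 = 3 * k ^+ 2 * inv n ^+ 4 by ring.
  rewrite /D; lra.
have w4L n : (0 < n)%N -> w4 n <= L4 * inv n ^+ 8.
  apply: (H4 w4) => {}n n0; first by have /andP[] := w4_itv pr n0.
  have := w4_step pr n0; rewrite kE.
  have r40 : 0 <= inv n ^+ 4 by rewrite exprn_ge0// ltW// inv_gt0.
  have h1 : w2 n ^+ 2 <= (L2 * inv n ^+ 4) ^+ 2.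
    have /andP[w20 _] := w2_itv pr n0.
    by rewrite ler_sqr ?nnegrE ?mulr_ge0// w2L.
  have h2 : (c n.+1 - phi n) ^+ 4 <= (D * inv n ^+ 4) ^+ 2.
    rewrite -[4%N in leLHS]/(2 * 2)%N exprM.
    by rewrite ler_sqr ?nnegrE ?sqr_ge0 ?mulr_ge0// dD.
  have -> : (k * inv n ^+ 2) ^+ 4 = k ^+ 4 * inv n ^+ 8 by ring.
  have /andP[w40 _] := w4_itv pr n0.
  have E x : (x * inv n ^+ 4) ^+ 2 = x ^+ 2 * inv n ^+ 8 :> R by ring.
  move: h1 h2; rewrite !E /K4; lra.
move=> n n0; apply: (le_trans (M_w4 pr n0)).
have x0 := nat_gt0 n0.
have h0 : 0 <= 16 * (b * n%:R) ^+ 8.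
  by rewrite mulr_ge0// exprn_ge0// mulr_ge0// ltW.
apply: (le_trans (ler_wpM2l h0 (w4L n n0))).
by rewrite le_eqVlt; apply/orP; left; apply/eqP; field; rewrite gt_eqF.
Qed.

(** Since [2 s] is the fixed point of [V |-> s + V / 2], the distance [|V n - 2 s|] contracts up to
    an error O(1/n) and decays at that rate; dividing by [m n >= a n] turns [V / (2 m)] into [s / m]
    within O(1/n^2). *)
Lemma profile_gap : exists2 K : R, 0 <= K &
  forall mu s w2 w4 V M m c phi q, moment_profile mu s w2 w4 V M m c phi q ->
  forall n, (0 < n)%N ->
    V n <= K /\ `|q n - s / m n| <= K * inv n ^+ 2.
Proof.
have [K4 K40 H] := profile_M_bounded.
pose A := a^-1 ^+ 2; pose KV := 1 + K4.
have A0 : 0 <= A by exact: sqr_ge0.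
have KV0 : 0 <= KV by rewrite /KV; lra.
have bb := sqr_ge0 b.
have AK0 : 0 <= A * K4 by rewrite mulr_ge0.
pose U := KV + 2 * b ^+ 2.
have U0 : 0 <= U by rewrite /U; lra.
pose C := b ^+ 2 + KV / 2 + 2 * (A * K4).
have C0 : 0 <= C by rewrite /C; lra.
have [LV LV0 HV] := contraction_decay 1 U0 C0.
pose Kq := A * (K4 + KV / 8) + a^-1 * LV / 2.
have Kq0 : 0 <= Kq.
  by rewrite /Kq addr_ge0// ?mulr_ge0 ?invr_ge0// ?(ltW a0)//; lra.
exists (KV + Kq); first exact: addr_ge0.
move=> mu s w2 w4 V M m c phi q pr.
have /andP[s0 sb] := s_itv pr.
have VK n : (0 < n)%N -> V n <= KV.
  move=> n0; have [v0 vM] := V_itv pr n0; have := H _ _ _ _ _ _ _ _ _ _ pr n n0.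
  have := sqr_ge0 (V n - 1); rewrite /KV; lra.
have anE n : ((a * n%:R) ^+ 2)^-1 = A * inv n ^+ 2.
  by rewrite -exprVn invfM exprMn.
have dV n : (0 < n)%N -> `|V n - 2 * s| <= LV * inv n.
  move=> n0; rewrite -[inv n]expr1.
  apply: (HV (fun n => `|V n - 2 * s|)) n n0 => n n0.
    have [v0 vM] := V_itv pr n0; have := VK n n0.
    by rewrite ler_norml /U => ?; apply/andP; split; lra.
  rewrite expr1; have r0 := inv_gt0 n0; have r1 := inv_le1 n0.
  (* The weight [t = 1/n] makes both errors, [t] times O(1) and [1 + n] times O(1/n^2), of order
     1/n. *)
  have := V_step pr n0 r0; rewrite invrK anE.
  have -> : V n.+1 - 2 * s =
    (V n.+1 - (s + V n / 2)) + 1 / 2 * (V n - 2 * s) by field.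
  move=> h; apply: (le_trans (ler_normD _ _)).
  rewrite [`|1 / 2 * _|]normrM [`|1 / 2|]ger0_norm; last lra.
  have h3 : 0 <= `|V n - 2 * s| by [].
  have h1 : inv n * (s + V n / 2) <= inv n * (b ^+ 2 + KV / 2).
    by rewrite ler_pM2l//; have := VK n n0; lra.
  have h2 : (1 + n%:R) * (M n * (A * inv n ^+ 2)) <= 2 * (A * K4) * inv n.
    have -> : (1 + n%:R) * (M n * (A * inv n ^+ 2)) =
      M n * (A * ((inv n + 1) * inv n)) by field; rewrite gt_eqF// nat_gt0.
    have -> : 2 * (A * K4) * inv n = K4 * (A * (2 * inv n)) by ring.
    apply: (@le_trans _ _ (K4 * (A * ((inv n + 1) * inv n)))).
      apply: ler_wpM2r; last exact: H pr n n0.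
      by rewrite mulr_ge0// mulr_ge0 ?addr_ge0// ltW.
    do 2 apply: ler_wpM2l => //.
    by apply: ler_wpM2r; [exact: ltW|lra].
  rewrite /C; lra.
move=> n n0; split; first by have := VK n n0; lra.
have /andP[m1 _] := m_itv pr n0; have x0 := nat_gt0 n0.
have an0 : 0 < a * n%:R by rewrite mulr_gt0.
have m0 : 0 < m n := lt_le_trans an0 m1.
have mi : (m n)^-1 <= a^-1 * inv n by rewrite -invfM lef_pV2 ?posrE.
have -> : q n - s / m n =
    (q n - V n / (2 * m n)) + (V n - 2 * s) * (m n)^-1 / 2.
  by field; rewrite gt_eqF.
apply: (le_trans (ler_normD _ _)).
have h1 := q_gap pr n0; rewrite anE in h1.
have r20 : 0 <= inv n ^+ 2 by exact: sqr_ge0.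
have h2 : `|(V n - 2 * s) * (m n)^-1 / 2| <= a^-1 * LV / 2 * inv n ^+ 2.
  rewrite normrM [`|2^-1|]ger0_norm; last by [].
  rewrite normrM [`|(m n)^-1|]gtr0_norm ?invr_gt0//.
  have : `|V n - 2 * s| * (m n)^-1 <= LV * inv n * (a^-1 * inv n).
    by apply: ler_pM => //; [rewrite invr_ge0 ltW|exact: dV].
  by rewrite expr2; lra.
have h3 : (M n + V n / 8) * (A * inv n ^+ 2) <=
    (K4 + KV / 8) * (A * inv n ^+ 2).
  apply: ler_wpM2r; first exact: mulr_ge0.
  by have := VK n n0; have := H _ _ _ _ _ _ _ _ _ _ pr n n0; lra.
have h4 : 0 <= KV * inv n ^+ 2 by rewrite mulr_ge0.
rewrite /Kq; lra.
Qed.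

Lemma profile_mean : exists2 M1 : R, 0 <= M1 &
  forall mu s w2 w4 V M m c phi q, moment_profile mu s w2 w4 V M m c phi q ->
  forall n, (0 < n)%N -> `|m n - mu * n%:R + s / mu * ln n%:R| <= M1.
Proof.
have [K K0 H] := profile_gap.
pose S := b ^+ 2 * a^-1; pose Q := S + K; pose Lam := `|ln a| + `|ln b|.
have S0 : 0 <= S by rewrite mulr_ge0 ?sqr_ge0 ?(ltW ai0).
have Q0 : 0 <= Q by rewrite addr_ge0.
have Lam0 : 0 <= Lam by rewrite addr_ge0.
pose Kg := K + S * (Q * a^-1) + S * ((b + Q) ^+ 2 * a^-1 ^+ 2).
have Kg0 : 0 <= Kg.
  by rewrite !addr_ge0// mulr_ge0// mulr_ge0 ?sqr_ge0// ltW.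
have SL0 : 0 <= S * Lam by rewrite mulr_ge0.
(* [2 * Kg] bounds [g n - g 1], [2 * b] covers [m 1 - mu], and [S * Lam] is paid for a logarithm at
   1 and at [n]. *)
exists (2 * Kg + 2 * b + 2 * (S * Lam)); first by have := ltW b0; lra.
move=> mu s w2 w4 V M m c phi q pr.
have /andP[mua mub] := mu_itv pr; have mu0 : 0 < mu := lt_le_trans a0 mua.
have /andP[s0 sb] := s_itv pr.
pose sg := s / mu; have sg0 : 0 <= sg by rewrite divr_ge0// ltW.
have sgS : sg <= S by apply: ler_pM => //; rewrite ?invr_ge0 ?lef_pV2 ?posrE// ltW.
have m_gt0 n : (0 < n)%N -> 0 < m n.
  move=> n0; have /andP[h _] := m_itv pr n0.
  by apply: lt_le_trans h; rewrite mulr_gt0 ?nat_gt0.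
have m_inv n : (0 < n)%N -> (m n)^-1 <= a^-1 * inv n.
  move=> n0; have /andP[h _] := m_itv pr n0.
  by rewrite -invfM lef_pV2 ?posrE ?m_gt0// mulr_gt0 ?nat_gt0.
have qQ n : (0 < n)%N -> `|q n| <= Q * inv n.
  move=> n0; have [_ h] := H _ _ _ _ _ _ _ _ _ _ pr n n0.
  have r0 := inv_gt0 n0; have r1 := inv_le1 n0.
  have -> : q n = (q n - s / m n) + s / m n by ring.
  apply: (le_trans (ler_normD _ _)).
  rewrite [`|s / m n|]ger0_norm ?divr_ge0 ?(ltW (m_gt0 _ n0))//.
  have h1 : s / m n <= b ^+ 2 * (a^-1 * inv n).
    by apply: ler_pM => //; [rewrite invr_ge0 ltW// m_gt0|exact: m_inv].
  have h2 : K * inv n ^+ 2 <= K * inv n.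
    by rewrite ler_wpM2l// expr2 ler_piMl// ltW.
  rewrite /Q /S; lra.
pose g n := m n + sg * ln (m n) - mu * n%:R.
have g_step n : (0 < n)%N -> `|g n.+1 - g n| <= Kg * inv n ^+ 2.
  move=> n0; have m0 := m_gt0 _ n0; have m'0 := m_gt0 _ (ltn0Sn n).
  have r0 := inv_gt0 n0; have r1 := inv_le1 n0.
  have mi := m_inv _ n0; have qi := qQ _ n0.
  have mi0 : 0 <= (m n)^-1 by rewrite invr_ge0 ltW.
  have mi'0 : 0 <= (m n.+1)^-1 by rewrite invr_ge0 ltW.
  have mi' : (m n.+1)^-1 <= a^-1 * inv n.
    apply: (le_trans (m_inv _ (ltn0Sn n))); rewrite ler_pM2l// lef_pV2 ?posrE.
    - by rewrite ler_nat.
    - by rewrite ltr0n.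
    - exact: nat_gt0.
  have [_ gap] := H _ _ _ _ _ _ _ _ _ _ pr n n0.
  have dE : m n.+1 - m n = mu - q n by rewrite (m_step pr n0); ring.
  pose e := ln (m n.+1) - ln (m n) - (m n.+1 - m n) / m n.
  (* The linear part of [sg * ln] contributes [sg * mu / m = s / m], cancelling the main part of
     [q]; [e] is the second-order remainder of [ln]. *)
  have -> : g n.+1 - g n = (s / m n - q n) - sg * (q n * (m n)^-1) + sg * e.
    rewrite /g /e dE (m_step pr n0) -natr1 /sg; field.
    by rewrite !gt_eqF.
  have h1 : `|q n * (m n)^-1| <= Q * a^-1 * inv n ^+ 2.
    rewrite normrM [`|(m n)^-1|]ger0_norm//.
    by rewrite (_ : Q * _ * _ = (Q * inv n) * (a^-1 * inv n)); [exact: ler_pM|ring].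
  have h2 : `|e| <= (b + Q) ^+ 2 * a^-1 ^+ 2 * inv n ^+ 2.
    have /andP[lo hi] := ln_ratio_bounds m'0 m0.
    have : `|e| <= (m n.+1 - m n) ^+ 2 * ((m n)^-1 * (m n.+1)^-1).
      have -> : (m n.+1 - m n) ^+ 2 * ((m n)^-1 * (m n.+1)^-1) =
        (m n.+1 - m n) / m n - (m n.+1 - m n) / m n.+1.
        by field; rewrite !gt_eqF.
      by rewrite /e ler_norml; apply/andP; split; lra.
    move=> h; apply: (le_trans h).
    have -> : (b + Q) ^+ 2 * a^-1 ^+ 2 * inv n ^+ 2 =
      (b + Q) ^+ 2 * ((a^-1 * inv n) * (a^-1 * inv n)) by ring.
    apply: ler_pM; [exact: sqr_ge0|by rewrite mulr_ge0| |exact: ler_pM].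
    rewrite dE -[leLHS]real_normK ?num_real// ler_sqr ?nnegrE ?addr_ge0 ?(ltW b0)//.
    apply: (le_trans (ler_normB _ _)); rewrite ger0_norm ?(ltW mu0)//.
    apply: lerD => //; apply: (le_trans qi); exact: ler_piMr.
  have h3 : `|sg * (q n * (m n)^-1)| <= S * (Q * a^-1 * inv n ^+ 2).
    by rewrite normrM [`|sg|]ger0_norm// ler_pM.
  have h4 : `|sg * e| <= S * ((b + Q) ^+ 2 * a^-1 ^+ 2 * inv n ^+ 2).
    by rewrite normrM [`|sg|]ger0_norm// ler_pM.
  rewrite distrC in gap.
  apply: (le_trans (ler_normD _ _)); apply: (le_trans (lerD (ler_normB _ _) h4)).
  by rewrite /Kg; lra.
have ln_in x : a <= x <= b -> `|ln x| <= Lam.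
  move=> /andP[xa xb]; have x0 : 0 < x := lt_le_trans a0 xa.
  have h1 : ln a <= ln x by rewrite ler_ln ?posrE.
  have h2 : ln x <= ln b by rewrite ler_ln ?posrE.
  have := ler_norm (ln b); have := ler_norm (- ln a); rewrite normrN.
  have := normr_ge0 (ln a); have := normr_ge0 (ln b).
  by rewrite ler_norml /Lam => *; apply/andP; split; lra.
have sln y : `|y| <= Lam -> `|sg * y| <= S * Lam.
  by move=> yL; rewrite normrM [`|sg|]ger0_norm// ler_pM.
move=> n n0; have := summable_increments Kg0 g_step n0.
have m1 : a <= m 1%N <= b by have := m_itv pr (ltn0Sn 0); rewrite !mulr1.
have g1 := sln _ (ln_in _ m1).
have mn : a <= m n / n%:R <= b.
  have x0 := nat_gt0 n0; rewrite ler_pdivlMr// ler_pdivrMr//.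
  by have := m_itv pr n0.
have g2 := sln _ (ln_in _ mn).
have lnE : ln (m n) = ln (m n / n%:R) + ln n%:R.
  by rewrite ln_div ?posrE ?nat_gt0 ?m_gt0//; ring.
rewrite /g lnE mulr1 -/sg; move: m1 => /andP[m1a m1b].
move: g1 g2; rewrite !ler_norml => /andP[? ?] /andP[? ?] /andP[? ?].
by move: a0 b0 => ? ?; apply/andP; split; lra.
Qed.

Lemma profile_asymptotics : exists M1 M2 : R,
  forall mu s w2 w4 V M m c phi q, moment_profile mu s w2 w4 V M m c phi q ->
  forall n, (0 < n)%N ->
    `|m n - mu * n%:R + s / mu * ln n%:R| <= M1 /\
    `|c n - (mu * n%:R)^-1 - s * ln n%:R / (mu ^+ 3 * n%:R ^+ 2)| <=
      M2 / n%:R ^+ 2.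
Proof.
have [M1 M10 H1] := profile_mean; have [K K0 H] := profile_gap.
pose S := b ^+ 2 * a^-1; have S0 : 0 <= S by rewrite mulr_ge0 ?sqr_ge0 ?(ltW ai0).
exists M1, (M1 * a^-1 ^+ 2 + (4 * S ^+ 2 + S * M1) * a^-1 ^+ 3 + K * a^-1 ^+ 3).
move=> mu s w2 w4 V M m c phi q pr n n0; split; first exact: (H1 _ _ _ _ _ _ _ _ _ _ pr).
have /andP[mua mub] := mu_itv pr; have mu0 : 0 < mu := lt_le_trans a0 mua.
have /andP[s0 sb] := s_itv pr.
pose sg := s / mu; have sg0 : 0 <= sg by rewrite divr_ge0// ltW.
have sgS : sg <= S by apply: ler_pM => //; rewrite ?invr_ge0 ?lef_pV2 ?posrE// ltW.
have /andP[mn _] := m_itv pr n0; have x0 := nat_gt0 n0.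
have m0 : 0 < m n by apply: lt_le_trans mn; rewrite mulr_gt0.
have mi : (m n)^-1 <= a^-1 * inv n by rewrite -invfM lef_pV2 ?posrE ?mulr_gt0.
have mui : mu^-1 <= a^-1 by rewrite lef_pV2 ?posrE.
have mi0 : 0 <= (m n)^-1 by rewrite invr_ge0 ltW.
have mui0 : 0 <= mu^-1 by rewrite invr_ge0 ltW.
have r0 := inv_gt0 n0; have r1 := inv_le1 n0.
have e1 := H1 _ _ _ _ _ _ _ _ _ _ pr n n0.
have [VK _] := H _ _ _ _ _ _ _ _ _ _ pr n n0.
have L2 := ln_sqr_le (R := R) n0.
have L1 : ln n%:R <= n%:R :> R by rewrite ltW// ln_sublinear.
have L0 : 0 <= ln n%:R :> R by rewrite ln_ge0// ler1n.
set L := ln n%:R in e1 L2 L1 L0 *; rewrite -/sg in e1.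
set e := m n - mu * n%:R + sg * L in e1.
have e2 : `|c n - (m n)^-1| <= K * a^-1 ^+ 3 * inv n ^+ 2.
  apply: (le_trans (c_inv pr n0)).
  have -> : V n / (a * n%:R) ^+ 3 = V n * (a^-1 ^+ 3 * inv n ^+ 2 * inv n).
    by field; rewrite !gt_eqF.
  have h0 : 0 <= a^-1 ^+ 3 * inv n ^+ 2.
    by rewrite mulr_ge0 ?sqr_ge0// exprn_ge0// ltW.
  have -> : K * a^-1 ^+ 3 * inv n ^+ 2 = K * (a^-1 ^+ 3 * inv n ^+ 2) by ring.
  apply: (@le_trans _ _ (K * (a^-1 ^+ 3 * inv n ^+ 2 * inv n))).
    by rewrite ler_wpM2r// mulr_ge0// ltW.
  by rewrite ler_wpM2l// ler_piMr.
have eE : m n = mu * n%:R - sg * L + e by rewrite /e; ring.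
(* Substituting [mu n - m = sg L - e] twice in [1 / m - 1 / (mu n)] isolates the logarithmic term;
   the rest is O(1/n^2) because [e] is bounded and [L^2 <= 4 n]. *)
have -> : c n - (mu * n%:R)^-1 - s * L / (mu ^+ 3 * n%:R ^+ 2) =
    (c n - (m n)^-1) - e * (inv n * ((m n)^-1 * mu^-1)) +
    (sg * (sg * L ^+ 2) - sg * (L * e)) * (inv n ^+ 2 * (mu^-1 ^+ 2 * (m n)^-1)).
  have hm : mu * n%:R - sg * L + e != 0 by rewrite -eE gt_eqF.
  have sE : s = sg * mu by rewrite /sg divfK// gt_eqF.
  rewrite sE eE; field.
  by rewrite hm !gt_eqF.
have h1 : `|e * (inv n * ((m n)^-1 * mu^-1))| <= M1 * (a^-1 ^+ 2 * inv n ^+ 2).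
  have p0 : 0 <= inv n * ((m n)^-1 * mu^-1) by rewrite !mulr_ge0// ltW.
  rewrite normrM [`|inv n * _|]ger0_norm//; apply: ler_pM => //.
  have -> : a^-1 ^+ 2 * inv n ^+ 2 = inv n * (a^-1 * inv n * a^-1) by ring.
  rewrite ler_pM2l//; apply: ler_pM => //.
have h2 : `|sg * (sg * L ^+ 2) - sg * (L * e)| <= (4 * S ^+ 2 + S * M1) * n%:R.
  have -> : (4 * S ^+ 2 + S * M1) * n%:R = S * (S * (4 * n%:R)) + S * (n%:R * M1).
    by ring.
  apply: (le_trans (ler_normB _ _)); apply: lerD.
    rewrite ger0_norm; last by rewrite !mulr_ge0 ?sqr_ge0.
    apply: ler_pM => //; first by rewrite mulr_ge0 ?sqr_ge0.
    by apply: ler_pM => //; exact: sqr_ge0.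
  rewrite normrM [`|L * e|]normrM [`|sg|]ger0_norm// [`|L|]ger0_norm//.
  apply: ler_pM => //; first by rewrite mulr_ge0.
  exact: ler_pM.
have h3 : `|(sg * (sg * L ^+ 2) - sg * (L * e)) *
    (inv n ^+ 2 * (mu^-1 ^+ 2 * (m n)^-1))| <=
    (4 * S ^+ 2 + S * M1) * (a^-1 ^+ 3 * inv n ^+ 2).
  have p0 : 0 <= inv n ^+ 2 * (mu^-1 ^+ 2 * (m n)^-1).
    by rewrite !mulr_ge0// exprn_ge0// ltW.
  rewrite normrM [`|inv n ^+ 2 * _|]ger0_norm//.
  have -> : (4 * S ^+ 2 + S * M1) * (a^-1 ^+ 3 * inv n ^+ 2) =
    (4 * S ^+ 2 + S * M1) * n%:R * (inv n ^+ 2 * (a^-1 ^+ 2 * (a^-1 * inv n))).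
    by field; rewrite !gt_eqF.
  apply: ler_pM => //; rewrite ler_pM2l ?exprn_gt0//.
  apply: ler_pM => //; first exact: sqr_ge0.
  by rewrite ler_sqr ?nnegrE// (ltW ai0).
rewrite -exprVn; move: h1 h3 e2; set A := e * _; set B := (_ - _) * _.
move=> h1 h3 h4; apply: (le_trans (ler_normD _ _)).
apply: (le_trans (lerD (ler_normB _ _) h3)).
by lra.
Qed.

End Profile.

(** * Integrals and null sets *)

Section Null_sets.
Set Implicit Arguments. Unset Strict Implicit.
Local Open Scope ereal_scope.
Context {d : measure_display} {T : measurableType d} {R : realType}
  (mu : {measure set T -> \bar R}).
Import HBNNSimple.

(* [ae_eq_integral] without measurability: the effective conductance is only
   controlled off a null set, where the resistances lie in [a, b] *)
Lemma null_set_integral (f g : T -> \bar R) (N : set T) :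
  measurable N -> mu N = 0 -> (forall x, ~ N x -> f x = g x) ->
  \int[mu]_x f x = \int[mu]_x g x.
Proof.
move=> mN N0.
have H (f1 f2 : T -> \bar R) : (forall x, ~ N x -> f1 x = f2 x) ->
    (forall x, 0 <= f2 x) ->
    ereal_sup [set sintegral mu h |
      h in [set h : {nnsfun T >-> R} | forall x, (h x)%:E <= f1 x]] <=
    ereal_sup [set sintegral mu h |
      h in [set h : {nnsfun T >-> R} | forall x, (h x)%:E <= f2 x]].
  move=> f12 f20; apply: ge_ereal_sup => _ [h hf1 <-].
  (* Setting [h] to 0 on [N] keeps its integral and puts it below [f2], which is nonnegative
     there. *)
  apply: ereal_sup_ubound; exists (proj_nnsfun h (measurableC mN)).
    move=> x; rewrite -mrestrict /patch; case: ifPn => [|_]; last exact: f20.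
    by rewrite inE => Nx; rewrite -f12.
  rewrite -!integralT_nnsfun -mrestrict.
  rewrite [RHS](ge0_negligible_integral mN measurableT)//.
  + rewrite setTD [RHS]integral_mkcond; apply: eq_integral => x _.
    by rewrite /patch; case: ifP.
  + exact/measurable_EFinP.
  + by move=> x _; rewrite lee_fin.
move=> fg; rewrite /integral !patch_setT.
by congr (_ - _); apply/eqP; rewrite eq_le; apply/andP; split; apply: H => //;
  move=> x Nx; rewrite ?funeposE ?funenegE fg.
Qed.

End Null_sets.

(** * The tree yields a moment profile *)

Section Tree_profile.
Set Implicit Arguments. Unset Strict Implicit.
Context {d : measure_display} {T : measurableType d} {R : realType}
  (P : probability T R).

(** The central moments compared are even ones, so that the integrands are nonnegative as
    [eq_law_Ex] requires. *)
Lemma eq_law_moments (U W : T -> R) : bounded_mfun U -> bounded_mfun W ->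
  (forall w, 0 <= U w) -> (forall w, 0 <= W w) ->
  (forall B : set R, measurable B -> P (U @^-1` B) = P (W @^-1` B)) ->
  [/\ Ex P U = Ex P W, cmoment P 2 U = cmoment P 2 W
    & cmoment P 4 U = cmoment P 4 W].
Proof.
move=> bU bW U0 W0 UW; have [[mU _] [mW _]] := (bU, bW).
have E1 : Ex P U = Ex P W.
  exact: (eq_law_Ex mU mW (measurable_id (D := setT)) U0 W0 UW).
have even k : ~~ odd k -> cmoment P k U = cmoment P k W.
  move=> ke; rewrite /cmoment E1.
  have mh : measurable_fun setT (fun x : R => (x - Ex P W) ^+ k).
    by apply: measurable_funX; exact: measurable_funB.
  by apply: (eq_law_Ex mU mW mh) => // w; rewrite exprn_even_ge0.
by split; [exact: E1|exact: even 2%N isT|exact: even 4%N isT].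
Qed.

Lemma cmoment2_bounds (f : T -> R) (K : R) : bounded_mfun f ->
  (forall w, 0 <= f w <= K) -> 0 <= cmoment P 2 f <= K ^+ 2.
Proof.
move=> bf fK; apply: Ex_bounds; bounded => w; rewrite sqr_ge0/=.
have /andP[f0 fk] := fK w; have /andP[m0 mk] := Ex_bounds P bf fK.
rewrite -[leLHS]real_normK ?num_real// ler_sqr ?nnegrE//; last lra.
by rewrite ler_norml; apply/andP; split; lra.
Qed.

Lemma cmoment4_bounds (f : T -> R) (K : R) : bounded_mfun f ->
  (forall w, 0 <= f w <= K) -> 0 <= cmoment P 4 f <= K ^+ 4.
Proof.
move=> bf fK; apply: Ex_bounds; bounded => w.
rewrite -[4%N]/(2 * 2)%N !exprM sqr_ge0/=.
have /andP[f0 fk] := fK w; have /andP[m0 mk] := Ex_bounds P bf fK.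
have h : `|f w - Ex P f| <= K by rewrite ler_norml; apply/andP; split; lra.
rewrite ler_sqr ?nnegrE ?sqr_ge0// -[leLHS]real_normK ?num_real//.
by rewrite ler_sqr ?nnegrE// (le_trans _ h).
Qed.

Context (a b : R) (Y : nat -> nat -> T -> R) (nu : probability R R).
Hypotheses (a0 : 0 < a) (Yab : forall k i w, a <= Y k i w <= b)
  (mY : forall k i, measurable_fun setT (Y k i))
  (iidY : indep_of P Y nu setT (fun=> True)).

Let Z m k i w := res (fun k i => Y k i w) m k i.

Let Z_bounds m k i w : a * m%:R <= Z m k i w <= b * m%:R.
Proof. exact: res_bounds. Qed.

Let Z_ge0 m k i w : 0 <= Z m k i w.
Proof. exact: (res_ge0 a0 Yab). Qed.

Lemma bounded_res m k i :
  bounded_mfun (fun w => res (fun k i => Y k i w) m k i).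
Proof.
split; first exact: (measurable_res a0 Yab mY).
exists (b * m%:R) => w; rewrite ger0_norm; last exact: Z_ge0.
by have /andP[] := Z_bounds m k i w.
Qed.

Let bZ m k i : bounded_mfun (Z m k i) := bounded_res m k i.

Let bY k i : bounded_mfun (Y k i).
Proof.
split=> //; exists b => w; have /andP[h1 h2] := Yab k i w.
by rewrite ger0_norm// (le_trans (ltW a0)).
Qed.

Let Zlaw m k i k' i' (B : set R) : measurable B ->
  P (Z m k i @^-1` B) = P (Z m k' i' @^-1` B).
Proof. exact: (res_eq_law a0 Yab mY iidY m k i k' i'). Qed.

Let biZ m k i : (0 < m)%N -> bounded_mfun (fun w => (Z m k i w)^-1).
Proof.
move=> m0; have am : 0 < a * m%:R by rewrite mulr_gt0// ltr0n.
by apply: (bounded_mfunV am) => // w; have /andP[] := Z_bounds m k i w.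
Qed.

Let iZlaw m k i k' i' (B : set R) : measurable B ->
  P ((fun w => (Z m k i w)^-1) @^-1` B) =
  P ((fun w => (Z m k' i' w)^-1) @^-1` B).
Proof.
move=> mB; have E k0 i0 : (fun w => (Z m k0 i0 w)^-1) =
    (fun x : R => x `^ (-1)) \o Z m k0 i0.
  by apply/funext => w; exact: esym (powR_inv1 (Z_ge0 m k0 i0 w)).
rewrite !E !comp_preimage; apply: Zlaw.
apply: measurable_preimage => //; exact: measurable_powR.
Qed.

(** By definition [Z n.+1 1 0] is [Y 1 0] plus the harmonic mean of [Z n 2 0] and [Z n 2 1]. These
    two have the law of [Z n 1 0], so the one-level inequalities become recursions in [n]. *)
Lemma tree_moment_profile : exists phi q : nat -> R,
  moment_profile a b (Ex P (Y 1 0)) (cmoment P 2 (Y 1 0))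
    (fun n => cmoment P 2 (fun w => (Z n 1 0 w)^-1))
    (fun n => cmoment P 4 (fun w => (Z n 1 0 w)^-1))
    (fun n => cmoment P 2 (Z n 1 0)) (fun n => cmoment P 4 (Z n 1 0))
    (fun n => Ex P (Z n 1 0)) (fun n => Ex P (fun w => (Z n 1 0 w)^-1)) phi q.
Proof.
pose mu := Ex P (Y 1 0).
exists (fun n => Ex P (fun w => (Z n 1 0 w)^-1) /
          (1 + mu * Ex P (fun w => (Z n 1 0 w)^-1))).
exists (fun n => Ex P (fun w => (Z n 2 0 w - Z n 2 1 w) ^+ 2 /
          (2 * (Z n 2 0 w + Z n 2 1 w)))).
have an n : (0 < n)%N -> 0 < a * n%:R by move=> n0; rewrite mulr_gt0// ltr0n.
have iZ_itv n w : (0 < n)%N -> 0 <= (Z n 1 0 w)^-1 <= a^-1.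
  move=> n0; have /andP[h _] := Z_bounds n 1 0 w.
  have ah : a <= Z n 1 0 w by apply: le_trans h; rewrite ler_peMr ?(ltW a0)// ler1n.
  have z0 := lt_le_trans a0 ah.
  by rewrite invr_ge0 (ltW z0)/= lef_pV2 ?posrE.
have inv0 n k i w : 0 <= (Z n k i w)^-1 by rewrite invr_ge0.
have eqU n k i := eq_law_moments (bZ n k i) (bZ n 1 0) (Z_ge0 n k i)
  (Z_ge0 n 1 0) (@Zlaw n k i 1 0).
have eqiU n (n0 : (0 < n)%N) k i := eq_law_moments (biZ k i n0) (biZ 1 0 n0)
  (inv0 n k i) (inv0 n 1 0) (@iZlaw n k i 1 0).
have UV n : independent_pair P (Z n 2 0) (Z n 2 1).
  exact: (res_sibling_indep a0 Yab mY iidY).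
have XU n : independent_pair P (Y 1 0) (Z n 2 0).
  exact: (root_res_indep a0 Yab mY iidY).
have XV n : independent_pair P (Y 1 0) (Z n 2 1).
  exact: (root_res_indep a0 Yab mY iidY).
split.
- exact: Ex_bounds.
- apply: cmoment2_bounds => // w; have /andP[h1 h2] := Yab 1 0 w.
  by rewrite h2 (le_trans (ltW a0)).
- by move=> n n0; apply: cmoment2_bounds (biZ 1 0 n0) _ => w; exact: iZ_itv.
- by move=> n n0; apply: cmoment4_bounds (biZ 1 0 n0) _ => w; exact: iZ_itv.
- move=> n n0; split; first by apply: Ex_ge0 => w; exact: sqr_ge0.
  have b2 : bounded_mfun (fun w => (Z n 1 0 w - Ex P (Z n 1 0)) ^+ 2) by bounded.
  apply: (le_trans (Ex_sqr_le P b2)); rewrite le_eqVlt; apply/orP; left.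
  by apply/eqP; apply: eq_Ex => w; rewrite -exprM.
- by move=> n n0; apply: Ex_bounds.
- move=> n n0; have [i1 i2 i4] := eqiU n n0 2%N 0%N.
  have [j1 j2 j4] := eqiU n n0 2%N 1%N.
  have := inv_moment2_step a0 (an n n0) (Yab 1 0) (Z_bounds n 2 0)
    (Z_bounds n 2 1) (bY 1 0) (bZ n 2 0) (bZ n 2 1) (UV n)
    (etrans j1 (esym i1)) (etrans j2 (esym i2)).
  by rewrite i1 i2.
- move=> n n0; have [i1 i2 i4] := eqiU n n0 2%N 0%N.
  have [j1 j2 j4] := eqiU n n0 2%N 1%N.
  have := inv_moment4_step a0 (an n n0) (Yab 1 0) (Z_bounds n 2 0)
    (Z_bounds n 2 1) (bY 1 0) (bZ n 2 0) (bZ n 2 1) (UV n)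
    (etrans j1 (esym i1)) (etrans j2 (esym i2)) (etrans j4 (esym i4)).
  by rewrite i1 i2 i4.
- move=> n n0.
  exact: (cmoment4_inv P (an n n0) (Z_bounds n 1 0) (bZ n 1 0)).
- move=> n t n0 t0; have [i1 i2 i4] := eqU n 2%N 0%N.
  have [j1 j2 j4] := eqU n 2%N 1%N.
  have := moment2_step (an n n0) (Z_bounds n 2 0)
    (Z_bounds n 2 1) (bY 1 0) (bZ n 2 0) (bZ n 2 1) (UV n) (XU n) (XV n)
    (etrans j1 (esym i1)) (etrans j2 (esym i2)) (etrans j4 (esym i4)) t0.
  by rewrite i2 i4.
- move=> n n0; have [i1 i2 i4] := eqU n 2%N 0%N.
  have [j1 j2 j4] := eqU n 2%N 1%N.
  have := Ex_step (an n n0) (Z_bounds n 2 0)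
    (Z_bounds n 2 1) (bY 1 0) (bZ n 2 0) (bZ n 2 1) (etrans j1 (esym i1)).
  by rewrite i1.
- move=> n n0; have [i1 i2 i4] := eqU n 2%N 0%N.
  have [j1 j2 j4] := eqU n 2%N 1%N.
  have := Ex_gap (an n n0) (Z_bounds n 2 0)
    (Z_bounds n 2 1) (bZ n 2 0) (bZ n 2 1) (UV n)
    (etrans j1 (esym i1)) (etrans j2 (esym i2)) (etrans j4 (esym i4)).
  by rewrite i1 i2 i4.
- move=> n n0; apply: Ex_inv_approx (an n n0) _ (bZ n 1 0) => w.
  by have /andP[] := Z_bounds n 1 0 w.
Qed.

End Tree_profile.

Section Clamp.
Set Implicit Arguments. Unset Strict Implicit.
Context {R : realType} (a b : R).

(** The [Xe k i] share the law of [X], hence lie in [[a, b]] only almost surely; clamping makes the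
    bounds hold at every point. *)
Definition clamp (r : R) : R := Num.max a (Num.min b r).

Lemma clamp_itv r : a <= b -> a <= clamp r <= b.
Proof. by move=> ab; rewrite /clamp le_max lexx/= ge_max ab ge_min lexx. Qed.

Lemma clamp_id r : a <= r <= b -> clamp r = r.
Proof. by move=> /andP[ar rb]; rewrite /clamp (min_idPr rb) (max_idPr ar). Qed.

Lemma measurable_clamp : measurable_fun setT clamp.
Proof. by apply: measurable_maxr => //; exact: measurable_minr. Qed.

End Clamp.

Lemma set_itvcc_compl {R : realType} (a b : R) :
  ~` `[a, b]%classic = [set r | ~~ (a <= r <= b)].
Proof.
by apply/seteqP; split => r; rewrite /setC /mkset in_itv/= => /negP.
Qed.

Lemma null_outside_itv {d : measure_display} {T : measurableType d}
    {R : realType} {P : probability T R} {a b : R} {f : nat -> nat -> T -> R} :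
  (forall k i, measurable_fun setT (f k i)) ->
  (forall k i, P (f k i @^-1` [set r | ~~ (a <= r <= b)]) = 0%E) ->
  exists N : set T, [/\ measurable N, P N = 0%E &
    forall w, ~ N w -> forall k i, a <= f k i w <= b].
Proof.
move=> mf f0; pose N := \bigcup_k \bigcup_i f k i @^-1` [set r | ~~ (a <= r <= b)].
have mki k i : measurable (f k i @^-1` [set r | ~~ (a <= r <= b)]).
  apply: measurable_preimage => //; rewrite -set_itvcc_compl.
  by apply: measurableC; exact: measurable_itv.
have mN : measurable N.
  by apply: bigcupT_measurable => k; exact: bigcupT_measurable.
exists N; split=> // [|w Nw k i].
  apply/(negligibleP _ mN); apply: negligible_bigcup => k.
  by apply: negligible_bigcup => i; apply/(negligibleP _ (mki k i)); exact: f0.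
by apply: contrapT => /negP h; apply: Nw; exists k => //; exists i.
Qed.

Theorem theorem5 (R : realType) (a b : R) :
  0 < a -> a < b ->
  exists M1 M2 : R,
  forall (d : measure_display) (T : measurableType d) (P : probability T R)
         (X : {RV P >-> R}) (Xe : nat -> nat -> {RV P >-> R}),
    (forall w, a <= X w <= b) ->
    (forall k i (A : set R), measurable A ->
       distribution P (Xe k i) A = distribution P X A) ->
    mutually_independent P (fun e : nat * nat => Xe e.1 e.2) ->
    let mu := fine 'E_P[X] in
    let sigma2 := fine 'V_P[X] in
    forall n : nat, (2 <= n)%N ->
      let ER := (\int[P]_w (eff_resistance n (fun k i => Xe k i w))%:E)%E in
      let EC := (\int[P]_w (eff_conductance n (fun k i => Xe k i w))%:E)%E in
      [/\ ER \is a fin_num, EC \is a fin_num,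
          `| fine ER - mu * n%:R + sigma2 / mu * ln n%:R | <= M1 &
          `| fine EC - (mu * n%:R)^-1 - sigma2 * ln n%:R / (mu ^+ 3 * n%:R ^+ 2) |
             <= M2 / n%:R ^+ 2].
Proof.
move=> a0 ab; have [M1 [M2 asym]] := profile_asymptotics a0 ab.
exists M1, M2 => d T P X Xe Xab law indep mu sigma2 n n2 ER EC.
have n0 : (0 < n)%N by exact: leq_trans n2.
pose Y k i w := clamp a b (Xe k i w).
pose nu : probability R R := distribution P X.
have Yab k i w : a <= Y k i w <= b by apply: clamp_itv; exact: ltW.
have mY k i : measurable_fun setT (Y k i).
  by apply: measurableT_comp => //; exact: measurable_clamp.
(* Clamping fixes [X] pointwise, so the clamped edges still have the law of [X]. *)
have preX (B : set R) : X @^-1` (clamp a b @^-1` B) = X @^-1` B.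
  by apply/seteqP; split => w; rewrite /preimage /mkset clamp_id.
have iidY : indep_of P Y nu setT (fun=> True).
  move=> J B uJ _ mB; pose B' e := clamp a b @^-1` B e.
  have mB' e : measurable (B' e).
    exact: measurable_preimage (measurable_clamp a b) (mB e).
  rewrite setTI probability_setT mul1e.
  have /(_ J B' uJ (fun e _ => mB' e)) := indep.
  rewrite -[cylinder Y J B]/[set w | forall e, e \in J -> B' e (Xe e.1 e.2 w)].
  move=> E; rewrite -[LHS]fineK; last first.
    by apply: fin_num_measure; apply: (measurable_cylinder mY J mB).
  rewrite [X in X%:E = _]E; congr (_%:E); apply: eq_bigr => e _; congr fine.
  have := law e.1 e.2 (B' e) (mB' e); rewrite /distribution /pushforward => ->.
  by rewrite preX.
have lawX (B : set R) : measurable B -> P (Y 1%N 0%N @^-1` B) = P (X @^-1` B).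
  move=> mB; rewrite -[in RHS]preX.
  have mB' := measurable_preimage (measurable_clamp a b) mB.
  exact: (law 1%N 0%N _ mB').
have bX : bounded_mfun (X : T -> R).
  split=> //; exists b => w; have /andP[h1 h2] := Xab w.
  by rewrite ger0_norm// (le_trans (ltW a0)).
have bY : bounded_mfun (Y 1%N 0%N).
  split=> //; exists b => w; have /andP[h1 h2] := Yab 1%N 0%N w.
  by rewrite ger0_norm// (le_trans (ltW a0)).
have X0 w : 0 <= X w by have /andP[h _] := Xab w; exact: le_trans (ltW a0) h.
have Y0 w : 0 <= Y 1%N 0%N w.
  by have /andP[h _] := Yab 1%N 0%N w; exact: le_trans (ltW a0) h.
have [eqmu eqs _] := eq_law_moments bY bX Y0 X0 lawX.
have muE : mu = Ex P (Y 1%N 0%N).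
  by rewrite /mu unlock eqmu.
have sE : sigma2 = cmoment P 2 (Y 1%N 0%N).
  rewrite eqs /sigma2 /variance unlock /cmoment [in LHS]unlock.
  by [].
have [phi [q pr]] := tree_moment_profile a0 Yab mY iidY.
have [resE condE] := asym _ _ _ _ _ _ _ _ _ _ pr n n0.
pose Z w := res (fun k i => Y k i w) n 1 0.
have bZ : bounded_mfun Z := bounded_res a0 Yab mY n 1 0.
have Zn w : a * n%:R <= Z w.
  by have /andP[] := res_bounds n 1 0 a0 (fun k i => Yab k i w).
have an : 0 < a * n%:R by rewrite mulr_gt0// ltr0n.
have biZ := bounded_mfunV an Zn bZ.
have null k i : P (Xe k i @^-1` [set r | ~~ (a <= r <= b)]) = 0%E.
  have mI : measurable [set r : R | ~~ (a <= r <= b)].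
    by rewrite -set_itvcc_compl; apply: measurableC; exact: measurable_itv.
  apply: (etrans (law k i _ mI)).
  rewrite /distribution /pushforward [X in P X](_ : _ = set0) ?measure0//.
  by apply/seteqP; split => w //; rewrite /preimage /mkset Xab.
have [N [mN N0 Nab]] := null_outside_itv (fun k i => @measurable_funPT _ _ _ _ (Xe k i)) null.
have XY w : ~ N w -> (fun k i => Xe k i w) = (fun k i => Y k i w).
  move=> Nw; apply/funext => k; apply/funext => i; apply: esym.
  exact: clamp_id (Nab w Nw k i).
have condZ w : eff_conductance n (fun k i => Y k i w) = (Z w)^-1.
  exact: (eff_conductanceE a0 (fun k i => Yab k i w) n0).
have EC_E : EC = (Ex P (fun w => (Z w)^-1))%:E.
  rewrite -Ex_EFin//; apply: (null_set_integral mN N0) => w /XY ->.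
  by rewrite condZ.
have ER_E : ER = (Ex P Z)%:E.
  rewrite -Ex_EFin//; apply: (null_set_integral mN N0) => w /XY ->.
  by rewrite /eff_resistance condZ invrK.
by rewrite ER_E EC_E muE sE; split.
Qed.
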